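(* Let $h=h(n)\ge 1$ be any integer stack capacity (possibly depending on $n$). Fix any probability distribution on $[0,1]\times[0,1]$ having a bounded probability density function, and let the instance $\mathcal{I}$ of $h$-OVERLAP-COLORING with $n$ intervals be generated by the unknown distribution model from this distribution. Let $\chi_h$ be the optimal number of colors for $\mathcal{I}$ and $\chi'_h$ the number of colors used by Algorithm B on $(\mathcal{I},h)$ (for any way of resolving the arbitrary choice in Algorithm B). Then there is a constant $K>0$, depending only on the distribution (not on $n$ or $h$), such that $$P\left(\frac{\chi'_h}{\chi_h}\le 1+K\,h\,n^{-1/2}\right)\to 1 \quad\text{as } n\to\infty,$$ i.e. $\chi'_h/\chi_h\le 1+O(hn^{-1/2})$ with high probability. Moreover, Algorithm B processes one interval (item) in $O(\log n)$ time.
   Context: Two intervals $[x_1,y_1]$ and $[x_2,y_2]$ overlap iff $x_1<x_2<y_1<y_2$ or $x_2<x_1<y_2<y_1$. The $h$-OVERLAP-COLORING problem: given a set $\mathcal{I}=\{I_1,\dots,I_n\}$ of closed intervals $I_i=[x_i,y_i]$ whose $2n$ endpoints are pairwise distinct, find a coloring of the intervals using a minimum number of colors such that (1) any two overlapping intervals get different colors and (2) for every real $t$ and every color $d$, at most $h$ intervals of color $d$ contain $t$. The minimum number of colors is denoted $\chi_h$. Online algorithms receive the intervals in increasing order of their starting points $x_i$ and must color each interval when it arrives, using only the intervals received so far. Unknown distribution model: $n$ pairs $(a,b)\in[0,1]\times[0,1]$ are drawn i.i.d. from a distribution with a bounded probability density function; each pair gives the interval $[\min(a,b),\max(a,b)]$.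 (With probability $1$ all endpoints are distinct.) An event $E_n$ holds with high probability (whp) if $P(E_n)\to1$ as $n\to\infty$. A chain is a sequence of intervals $J_1\supseteq J_2\supseteq\dots\supseteq J_m$; $J_1$ is its bottom and $J_m$ its top. Algorithm B (input: intervals $I_1,\dots,I_n$, $I_i=[x_i,y_i]$, with $x_1<x_2<\dots<x_n$, and $h$). Maintain a collection $\mathcal{C}$ of chains (initially empty), a set $\mathcal{D}$ of pairs (color, time) (initially empty), and a counter $\chi=0$. For $i=1,\dots,n$: set bottom $:=$ false. Let $\mathcal{H}$ be the set of chains in $\mathcal{C}$ whose top interval contains $I_i$. If $\mathcal{H}=\emptyset$, add a new chain consisting of $I_i$ alone to $\mathcal{C}$ and set bottom $:=$ true. Otherwise let $c_J$ be the chain in $\mathcal{H}$ whose top interval $J=[x_J,y_J]$ has the smallest $y_J$; put $I_i$ on top of $c_J$; let $d$ be the color of $J$; if fewer than $h$ intervals in $c_J$ have color $d$, give $I_i$ color $d$, else set bottom $:=$ true. If bottom is true: let $\mathcal{G}=\{(d,y)\in\mathcal{D}: y<x_i\}$; if $\mathcal{G}=\emptyset$, set $\chi:=\chi+1$, give $I_i$ color $\chi$ and add $(\chi,y_i)$ to $\mathcal{D}$; otherwise pick any $(d,y)\in\mathcal{G}$, give $I_i$ color $d$ and replace $(d,y)$ in $\mathcal{D}$ by $(d,y_i)$. The number of colors used is $\chi'_h$ (the final value of $\chi$). *)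

(* Defs.v *)
From mathcomp Require Import all_boot all_order all_algebra.
From mathcomp Require Import all_classical all_reals all_analysis.

Set Implicit Arguments.
Unset Strict Implicit.
Unset Printing Implicit Defensive.

Import Order.TTheory GRing.Theory Num.Theory.
Import numFieldNormedType.Exports.

Local Open Scope classical_set_scope.
Local Open Scope ring_scope.

(* The pair (x, y) stands for the closed interval [x, y]. *)
Definition interv (R : realType) : Type := (R * R)%type.

Definition overlap (R : realType) (I J : interv R) : bool :=
  ((I.1 < J.1) && (J.1 < I.2) && (I.2 < J.2)) ||
  ((J.1 < I.1) && (I.1 < J.2) && (J.2 < I.2)).

Definition valid_coloring (R : realType) (h n k : nat) (I : 'I_n -> interv R)
    (c : 'I_n -> 'I_k) : Prop :=
  (forall i j, overlap (I i) (I j) -> c i <> c j) /\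
  (forall (t : R) (d : 'I_k),
     (#|[set i | (c i == d) && ((I i).1 <= t <= (I i).2)%R]%SET| <= h)%N).

Definition colorable (R : realType) (h n : nat) (I : 'I_n -> interv R)
    (k : nat) : Prop := exists c : 'I_n -> 'I_k, valid_coloring h I c.

(* The default value 0 is irrelevant: a minimum exists as soon as 0 < h, see
   [opt_colorsP]. *)
Definition opt_colors (R : realType) (h n : nat) (I : 'I_n -> interv R) : nat :=
  xget 0%N [set k | colorable h I k /\
                    forall k', colorable h I k' -> (k <= k')%N].

Lemma opt_colorsP (R : realType) (h n : nat) (I : 'I_n -> interv R) :
  (0 < h)%N ->
  colorable h I (opt_colors h I) /\
  forall k, colorable h I k -> (opt_colors h I <= k)%N.
Proof.
move=> h0.
have ex : exists k, `[< colorable h I k >].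
  exists n; apply/asboolP; exists id; split=> [i j|t d].
    by move=> ov ij; move: ov; rewrite ij /overlap ltxx.
  apply: leq_trans h0; rewrite -(cards1 d); apply/subset_leq_card/fintype.subsetP => i.
  by rewrite !inE => /andP[].
rewrite /opt_colors; case: xgetP => [k _ //|/(_ (ex_minn ex)) []].
case: ex_minnP => k /asboolP kP kmin; split=> // k' k'P.
by apply: kmin; apply/asboolP.
Qed.

Definition contains (R : realType) (J I : interv R) : bool :=
  (J.1 <= I.1) && (I.2 <= J.2).

(* A chain is the list of its colored intervals, the top one first. *)
Definition chain (R : realType) : Type := seq (interv R * nat).

Definition top_contains (R : realType) (I : interv R) (c : chain R) : bool :=
  if c is (J, _) :: _ then contains J I else false.

Record stateB (R : realType) : Type := StateB {
  chains : seq (chain R);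
  times  : seq (nat * R);   (* the set D of (color, time) pairs *)
  ncol   : nat              (* the counter chi *)
}.

Definition initB (R : realType) : stateB R := StateB [::] [::] 0.

(* [bottom_color D chi I d D' chi'] : when the set of pairs is D and the
   counter is chi, the bottom interval I may receive color d, after which the
   set of pairs is D' and the counter is chi'. *)
Inductive bottom_color (R : realType) (D : seq (nat * R)) (chi : nat)
    (I : interv R) : nat -> seq (nat * R) -> nat -> Prop :=
| BottomNew :
    (forall p, p \in D -> ~~ (p.2 < I.1)) ->
    bottom_color D chi I chi.+1 ((chi.+1, I.2) :: D) chi.+1
| BottomReuse (D1 D2 : seq (nat * R)) (d : nat) (y : R) :
    D = D1 ++ (d, y) :: D2 -> y < I.1 ->
    bottom_color D chi I d (D1 ++ (d, I.2) :: D2) chi.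

Definition count_color (R : realType) (d : nat) (c : chain R) : nat :=
  count (fun p => p.2 == d) c.

(* [best_chain I C1 J d c C2] : among the chains of C1 ++ ((J, d) :: c) :: C2
   whose top contains I, the top J of the exhibited one has the smallest right
   endpoint. *)
Definition best_chain (R : realType) (I : interv R) (C1 : seq (chain R))
    (J : interv R) (d : nat) (c : chain R) (C2 : seq (chain R)) : Prop :=
  contains J I /\
  forall J' d' c', (J', d') :: c' \in C1 ++ ((J, d) :: c) :: C2 ->
    contains J' I -> J.2 <= J'.2.

(* [stepB h s I d s'] : from state s, the interval I may receive color d and
   lead to the state s'. *)
Inductive stepB (R : realType) (h : nat) (s : stateB R) (I : interv R) :
    nat -> stateB R -> Prop :=
| StepNewChain (d : nat) (D' : seq (nat * R)) (chi' : nat) :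
    ~~ has (top_contains I) (chains s) ->
    bottom_color (times s) (ncol s) I d D' chi' ->
    stepB h s I d (StateB ([:: (I, d)] :: chains s) D' chi')
| StepSameColor C1 J d c C2 :
    chains s = C1 ++ ((J, d) :: c) :: C2 ->
    best_chain I C1 J d c C2 ->
    (count_color d ((J, d) :: c) < h)%N ->
    stepB h s I d
      (StateB (C1 ++ ((I, d) :: (J, d) :: c) :: C2) (times s) (ncol s))
| StepBottom C1 J dJ c C2 (d : nat) (D' : seq (nat * R)) (chi' : nat) :
    chains s = C1 ++ ((J, dJ) :: c) :: C2 ->
    best_chain I C1 J dJ c C2 ->
    (h <= count_color dJ ((J, dJ) :: c))%N ->
    bottom_color (times s) (ncol s) I d D' chi' ->
    stepB h s I d (StateB (C1 ++ ((I, d) :: (J, dJ) :: c) :: C2) D' chi').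

(* [runB h s Is ds s'] : from state s, algorithm B fed with the list Is may
   output the list of colors ds and end in state s'. *)
Fixpoint runB (R : realType) (h : nat) (s : stateB R) (Is : seq (interv R))
    (ds : seq nat) (s' : stateB R) : Prop :=
  match Is, ds with
  | [::], [::] => s' = s
  | J :: Is', d :: ds' => exists s1, stepB h s J d s1 /\ runB h s1 Is' ds' s'
  | _, _ => False
  end.

Lemma bottom_color_total (R : realType) (D : seq (nat * R)) (chi : nat)
  (I : interv R) : exists d D' chi', bottom_color D chi I d D' chi'.
Proof.
have [/hasP[[d y] dyD yI]|/hasPn noD] := boolP (has (fun p => p.2 < I.1) D).
  have [D1 D2] := splitPr dyD.
  by exists d, (D1 ++ (d, I.2) :: D2), chi; exact: BottomReuse erefl yI.
by exists chi.+1, ((chi.+1, I.2) :: D), chi.+1; exact: BottomNew.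
Qed.

Lemma best_chain_exists (R : realType) (I : interv R) (C : seq (chain R)) :
  has (top_contains I) C ->
  exists C1 J d c C2, C = C1 ++ ((J, d) :: c) :: C2 /\ best_chain I C1 J d c C2.
Proof.
move=> hC.
have [J [d [c [cC cJ Jmin]]]] : exists J d c, [/\ ((J, d) :: c) \in C,
    contains J I & forall J' d' c', ((J', d') :: c') \in C ->
      contains J' I -> J.2 <= J'.2].
  elim: C hC => [//|c0 C IHC].
  have [/IHC[J [d [c [cC cJ Jmin]]]] _|noC] := boolP (has (top_contains I) C).
    case: c0 => [|[J0 d0] c0].
      exists J, d, c; split; [by rewrite inE cC orbT|by []|move=> J' d' c'].
      by rewrite inE /=; exact: Jmin.
    have [/andP[J0I J0J]|noJ0] := boolP (contains J0 I && (J0.2 <= J.2)).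
      exists J0, d0, c0; split; [by rewrite inE eqxx|by []|move=> J' d' c'].
      rewrite inE => /orP[/eqP[-> _ _] //|c'C /(Jmin _ _ _ c'C)].
      exact: le_trans.
    exists J, d, c; split; [by rewrite inE cC orbT|by []|move=> J' d' c'].
    rewrite inE => /orP[/eqP[-> _ _]|]; last exact: Jmin.
    by move=> J0I; move: noJ0; rewrite J0I /= -ltNge => /ltW.
  case: c0 => [|[J0 d0] c0]; rewrite /= ?(negbTE noC) ?orbF // => J0I.
  exists J0, d0, c0; split; [by rewrite inE eqxx|by []|move=> J' d' c'].
  rewrite inE => /orP[/eqP[-> //]|c'C cJ'I].
  by move/hasPn : noC => /(_ _ c'C); rewrite /= cJ'I.
move: Jmin; have [C1 C2] := splitPr cC => Jmin.
by exists C1, J, d, c, C2; split.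
Qed.

Lemma runB_total (R : realType) (h : nat) (s : stateB R) (Is : seq (interv R)) :
  exists ds s', runB h s Is ds s'.
Proof.
elim: Is s => [s|I Is IH s]; first by exists [::], s.
have [d [s1 s1P]] : exists d s1, stepB h s I d s1.
  have [d [D' [chi' bc]]] := bottom_color_total (times s) (ncol s) I.
  have [|noC] := boolP (has (top_contains I) (chains s)); last first.
    by do 2!eexists; exact: StepNewChain bc.
  move=> /best_chain_exists[C1 [J [dJ [c [C2 [sE best]]]]]].
  have [lt|ge] := ltnP (count_color dJ ((J, dJ) :: c)) h.
    by do 2!eexists; exact: StepSameColor sE best lt.
  by do 2!eexists; exact: StepBottom sE best ge bc.
have [ds [s' s'P]] := IH s1.
by exists (d :: ds), s', s1.
Qed.

Notation plane R := (measurableTypeR R * measurableTypeR R)%type.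

Definition interv_of (R : realType) (p : R * R) : interv R :=
  (Num.min p.1 p.2, Num.max p.1 p.2).

Definition online_input (R : realType) (n : nat) (I : 'I_n -> interv R) :
    seq (interv R) :=
  sort (fun J1 J2 : interv R => J1.1 <= J2.1) [seq I i | i <- enum 'I_n].

Definition bounded_pdf_on_unit_square (R : realType)
    (mu : probability (plane R) R) : Prop :=
  mu (`[0, 1] `*` `[0, 1]) = 1%E /\
  exists (f : plane R -> R) (M : R),
    [/\ measurable_fun setT f,
        forall p, 0 <= f p <= M &
        forall A, measurable A ->
          mu A = (\int[lebesgue_measure \x lebesgue_measure]_(p in A)
                     (f p)%:E)%E].

Definition iid (d : measure_display) (T : measurableType d) (R : realType)
    (P : probability T R) (mu : probability (plane R) R) (n : nat)
    (X : 'I_n -> {RV P >-> plane R}) : Prop :=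
  (forall i A, measurable A -> distribution P (X i) A = mu A) /\
  (forall (S : {set 'I_n}) (A : 'I_n -> set (plane R)),
     (forall i, measurable (A i)) ->
     P (\bigcap_(i in [set` S]) (X i @^-1` A i)) =
     (\prod_(i in S) P (X i @^-1` A i))%E).

(* With high probability, for events on possibly different probability
   spaces. *)
Definition whp (R : realType) (d : nat -> measure_display)
    (T : forall n, measurableType (d n)) (P : forall n, probability (T n) R)
    (E : forall n, set (T n)) : Prop :=
  (forall n, measurable (E n)) /\ P n (E n) @[n --> \oo] --> 1%E.

(* Running times are measured on a unit-cost RAM whose word arithmetic is
   limited to addition, subtraction and halving.
   The memory consists of unbounded arrays of natural numbers and unbounded
   arrays of reals, both named by natural numbers; a program mentions finitely
   many of them. *)
Record memory (R : realType) : Type := Memory {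
  words : nat -> nat -> nat;
  reals : nat -> nat -> R
}.

Inductive expr : Type :=
| Const of nat
| Word of nat & expr              (* array, index *)
| Add of expr & expr
| Sub of expr & expr              (* truncated *)
| Half of expr.

(* Reals can only be compared and copied. *)
Inductive test : Type :=
| LtWord of expr & expr
| LtReal of nat & expr & nat & expr   (* array, index, array, index *)
| Not of test
| And of test & test.

Inductive cmd : Type :=
| Skip
| SetWord of nat & expr & expr           (* words a e1 := e2 *)
| SetReal of nat & expr & nat & expr     (* reals a e1 := reals b e2 *)
| Seq of cmd & cmd
| If of test & cmd & cmd
| While of test & cmd.

Fixpoint eval (R : realType) (m : memory R) (e : expr) : nat :=
  match e with
  | Const k => k
  | Word a e => words m a (eval m e)
  | Add e1 e2 => (eval m e1 + eval m e2)%N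
  | Sub e1 e2 => (eval m e1 - eval m e2)%N
  | Half e => (eval m e)./2
  end.

Fixpoint holds (R : realType) (m : memory R) (t : test) : bool :=
  match t with
  | LtWord e1 e2 => (eval m e1 < eval m e2)%N
  | LtReal a e1 b e2 => reals m a (eval m e1) < reals m b (eval m e2)
  | Not t => ~~ holds m t
  | And t1 t2 => holds m t1 && holds m t2
  end.

Definition upd (V : Type) (f : nat -> nat -> V) (a i : nat) (v : V) :
    nat -> nat -> V :=
  fun b j => if (b == a) && (j == i) then v else f b j.

Definition set_word (R : realType) (m : memory R) (a i v : nat) : memory R :=
  Memory (upd (words m) a i v) (reals m).

Definition set_real (R : realType) (m : memory R) (a i : nat) (v : R) :
    memory R :=
  Memory (words m) (upd (reals m) a i v).

(* [exec c m t m'] : from memory m, the command c terminates in memory m' after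
   t elementary steps.  Each assignment, skip and evaluation of a test is one
   step; since the expressions of a given program have bounded size, charging
   for their size would only change t by a constant factor. *)
Inductive exec (R : realType) : cmd -> memory R -> nat -> memory R -> Prop :=
| ExecSkip m : exec Skip m 1 m
| ExecSetWord a e1 e2 m :
    exec (SetWord a e1 e2) m 1 (set_word m a (eval m e1) (eval m e2))
| ExecSetReal a e1 b e2 m :
    exec (SetReal a e1 b e2) m 1
      (set_real m a (eval m e1) (reals m b (eval m e2)))
| ExecSeq c1 c2 m m1 m2 t1 t2 :
    exec c1 m t1 m1 -> exec c2 m1 t2 m2 -> exec (Seq c1 c2) m (t1 + t2) m2
| ExecIfTrue b c1 c2 m m' t :
    holds m b -> exec c1 m t m' -> exec (If b c1 c2) m t.+1 m'
| ExecIfFalse b c1 c2 m m' t :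
    ~~ holds m b -> exec c2 m t m' -> exec (If b c1 c2) m t.+1 m'
| ExecWhileFalse b c m : ~~ holds m b -> exec (While b c) m 1 m
| ExecWhileTrue b c m m1 m2 t1 t2 :
    holds m b -> exec c m t1 m1 -> exec (While b c) m1 t2 m2 ->
    exec (While b c) m (t1 + t2).+1 m2.

(* Initially the memory is null except for the capacity h in word (0, 0). *)
Definition init_memory (R : realType) (h : nat) : memory R :=
  set_word (Memory (fun _ _ => 0%N) (fun _ _ => 0)) 0 0 h.

(* The endpoints of an arriving interval are put in the reals (0, 0), (0, 1). *)
Definition receive (R : realType) (m : memory R) (I : interv R) : memory R :=
  set_real (set_real m 0 0 I.1) 0 1 I.2.

(* [processes p b m Is ds] : starting from memory m, the program p, executed
   once for each successive interval of the list Is, leaves the successive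
   colors of the list ds in word (1, 0), each execution taking at most b
   steps. *)
Fixpoint processes (R : realType) (p : cmd) (b : R) (m : memory R)
    (Is : seq (interv R)) (ds : seq nat) : Prop :=
  match Is, ds with
  | [::], [::] => True
  | J :: Is', d :: ds' => exists (t : nat) (m' : memory R),
      [/\ exec p (receive m J) t m', t%:R <= b, words m' 1 0 = d &
          processes p b m' Is' ds']
  | _, _ => False
  end.

(* Intervals listed by increasing starting points, all endpoints distinct. *)
Definition valid_input (R : realType) (Is : seq (interv R)) : Prop :=
  [/\ all (fun J : interv R => J.1 < J.2) Is,
      sorted (fun J1 J2 : interv R => J1.1 < J2.1) Is &
      uniq ([seq J.1 | J <- Is] ++ [seq J.2 | J <- Is])].

(* Main.v *)
Require Import Defs.
From mathcomp Require Import all_boot all_order all_algebra.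
From mathcomp Require Import all_classical all_reals all_analysis.
From mathcomp Require Import measurable_realfun.
From mathcomp Require Import zify lra ring.

(* Ratio.  Since intervals arrive by increasing start, placing each one on the
   chain with the smallest top is patience sorting of the right ends, so the
   number of chains is the size of a subsequence increasing in both ends.  In a
   chain, the intervals alive at a time t form a lower part in which every color
   but the topmost occurs at least h times.  When a new color is opened at time t,
   all the colors in use are alive at t, so their number is at most
   (number of intervals containing t) / h + (number of chains), and an optimal
   coloring bounds the first term by chi_h.  Hence chi'_h <= chi_h + #chains.

   An increasing sequence lies in a monotone staircase of 2N cells of an N x N
   grid, N ~ sqrt n; a staircase has mass O(1/N) since the density is bounded, and
   there are at most 4^N of them, so by a union bound there are O(sqrt n) chains
   whp.  On the other hand some point t is covered by a random interval with
   positive probability, so whp linearly many intervals contain t and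
   chi_h >= c n / h.  The event is measurable because it depends only on the finite
   order pattern of the endpoints.

   Time.  The tops are sorted by age, so the best chain is found by binary search;
   the pairs (color, time) are the leaves of a tournament tree, whose root gives
   the pair with the smallest time. *)

Set Implicit Arguments.
Unset Strict Implicit.
Unset Printing Implicit Defensive.

Import Order.TTheory GRing.Theory Num.Theory.
Import numFieldNormedType.Exports.

Local Open Scope classical_set_scope.
Local Open Scope ring_scope.

(** * Invariants of Algorithm B *)

Lemma uniq_count_bound (T : eqType) (h : nat) (S l : seq T) :
  uniq S -> (forall d, d \in S -> (h <= count_mem d l)%N) ->
  (size S * h <= size l)%N.
Proof.
elim: S l => [|d S IH] l //= /andP[dS uS] hl.
have -> : size l = (count_mem d l + size [seq x <- l | x != d])%N.
  by rewrite size_filter -(count_predC (pred1 d)).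
rewrite mulSn leq_add ?hl ?mem_head //; apply: IH => // e eS.
rewrite count_filter; apply: leq_trans (hl e _) _; first by rewrite inE eS orbT.
rewrite leq_eqVlt; apply/orP; left; apply/eqP/eq_count => x /=.
by case: (eqVneq x e) => [->|//]; case: eqVneq dS => // <-; rewrite eS.
Qed.

Section AlgorithmB.
Variables (R : realType) (h : nat).
Implicit Types (I J : interv R) (c : chain R) (s : stateB R) (t : R).
Implicit Types (past : seq (interv R)) (C : seq (chain R)).

(* A color is left only once it occurs h times, and by nestedness the intervals
   alive at a given time form a suffix of the list, itself a valid chain. *)
Fixpoint chain_ok c : bool :=
  if c is (J, d) :: c' then
    [&& chain_ok c', all (fun p => J.2 <= p.1.2) c' &
        all (fun p => (p.2 == d) || (h <= count_color p.2 c')%N) c']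
  else true.

Definition alive t J : bool := t <= J.2.

(** If the top is alive, so is the whole chain, and every color below it other than the top color
    occurs at least [h] times there; the summand [h] pays for the top color. A dead top is
    dropped. *)
Lemma chain_ok_alive_colors c t : chain_ok c ->
  (size (undup [seq p.2 | p <- c & alive t p.1]) * h <=
   count (fun p => alive t p.1) c + h)%N.
Proof.
elim: c => [|[J d] c IH] //= /and3P[okc /allP leJ /allP cntJ].
case: ifPn => [tJ|tJ]; last by rewrite add0n; exact: IH.
have -> : [seq p <- c | alive t p.1] = c.
  by apply/all_filterP/allP => p /leJ; exact: le_trans.
have -> : count (fun p => alive t p.1) c = size c.
  by apply/eqP; rewrite -all_count; apply/allP => p /leJ; exact: le_trans.
set u := undup _; have := @uniq_count_bound _ h (rem d u) [seq p.2 | p <- c].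
rewrite rem_uniq ?undup_uniq // size_map => /(_ isT) bnd.
have {}bnd : (size (rem d u) * h <= size c)%N.
  apply: bnd => e; rewrite mem_rem_uniq ?undup_uniq // inE => /andP[ed].
  rewrite mem_undup inE (negbTE ed) => /mapP[p pc pe].
  by rewrite pe in ed *; have := cntJ _ pc; rewrite (negbTE ed) count_map.
have : (size u <= (size (rem d u)).+1)%N.
  by have [du|du] := boolP (d \in u); [rewrite size_rem //; lia|rewrite rem_id].
move=> su; apply: leq_trans (leq_mul su (leqnn h)) _; rewrite mulSn; lia.
Qed.

Definition top_interval c : interv R := if c is (J, _) :: _ then J else (0, 0).

Definition le_interv I J : bool := (I.1 <= J.1) && (I.2 <= J.2).

Lemma le_interv_trans : transitive le_interv.
Proof.
move=> J I K /andP[a b] /andP[c d]; apply/andP.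
by split; [apply: le_trans a c|apply: le_trans b d].
Qed.

(* The k-th oldest top ends an increasing subsequence of length k, as in
   patience sorting. *)
Fixpoint tops_lis past C : Prop :=
  if C is c :: C' then
    (exists q, [/\ subseq (rcons q (top_interval c)) past,
                   sorted le_interv (rcons q (top_interval c)) & size q = size C'])
    /\ tops_lis past C'
  else True.

(** By [inv_end_le] and [inv_witness], the time paired with a color is the largest right end among
    the intervals of that color. New chains are put in front, so [inv_tops] and [inv_lis] read the
    chains from the newest to the oldest. *)
Record invB past s : Prop := InvB {
  inv_perm : perm_eq [seq p.1 | p <- flatten (chains s)] past;
  inv_chain : all chain_ok (chains s);
  inv_nonempty : all (fun c => c != [::]) (chains s);
  inv_tops : sorted (fun c c' => (top_interval c').2 < (top_interval c).2) (chains s);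
  inv_lis : tops_lis past (chains s);
  inv_uniq : uniq [seq p.1 | p <- times s];
  inv_size : size (times s) = ncol s;
  inv_times_le : forall p, p \in times s -> (p.1 <= ncol s)%N;
  inv_color_le : forall p, p \in flatten (chains s) -> (p.2 <= ncol s)%N;
  inv_end_le : forall p q, p \in flatten (chains s) -> q \in times s ->
    p.2 = q.1 -> p.1.2 <= q.2;
  inv_witness : forall q, q \in times s ->
    exists p, [/\ p \in flatten (chains s), p.2 = q.1 & p.1.2 = q.2] }.

Lemma initB_inv : invB [::] (initB R).
Proof. by split. Qed.

(** By [inv_witness], each of the [ncol s] colors has an interval alive at [t], so it is counted in
    some chain; [chain_ok_alive_colors] is then summed over the chains. *)
Lemma times_bound past s t : invB past s ->
  (forall p, p \in times s -> t <= p.2) ->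
  (h * ncol s <= count (alive t) past + h * size (chains s))%N.
Proof.
move=> inv tD.
pose cols c := undup [seq p.2 | p <- c & alive t p.1].
have szD : (ncol s <= size (flatten [seq cols c | c <- chains s]))%N.
  rewrite -(inv_size inv) -(size_map (@fst _ _) (times s)).
  apply: uniq_leq_size (inv_uniq inv) _ => d /mapP[q qD ->].
  have [p [/flattenP[c cs pc] pq pe]] := inv_witness inv qD.
  apply/flattenP; exists (cols c); first exact: map_f.
  rewrite mem_undup; apply/mapP; exists p => //.
  by rewrite mem_filter pc andbT /alive pe tD.
rewrite mulnC; apply: leq_trans (leq_mul szD (leqnn h)) _.
have /permP/(_ (alive t)) <- := inv_perm inv.
rewrite count_map size_flatten.
elim: (chains s) (inv_chain inv) => [|c C IH] //= /andP[okc okC].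
rewrite count_cat mulnDl mulnS.
have := IH okC; have := chain_ok_alive_colors t okc.
rewrite /cols /preim /=; move: (count _ c) (count _ (flatten C)) (size _ * h)%N.
by move: (sumn _ * h)%N => a b e f; lia.
Qed.

Lemma tops_lis_sub past past' C : subseq past past' ->
  tops_lis past C -> tops_lis past' C.
Proof.
move=> sub; elim: C => //= c C IH [[q [qs qo qn]] /IH {}IH]; split=> //.
by exists q; split=> //; apply: subseq_trans qs sub.
Qed.

(** The condition on a chain involves the older chains only through their number, so the chains in
    front of a modified one keep their subsequences. *)
Lemma tops_lis_replace past C1 c c' C2 :
  tops_lis past (C1 ++ c :: C2) -> tops_lis past (c' :: C2) ->
  tops_lis past (C1 ++ c' :: C2).
Proof.
elim: C1 => [|c1 C1 IH] /= => [_ //|[[q [qs qo qn]] rest] H]; split; last exact: IH.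
by exists q; split=> //; rewrite qn !size_cat.
Qed.

Lemma tops_lis_drop past C1 C2 : tops_lis past (C1 ++ C2) -> tops_lis past C2.
Proof. by elim: C1 => //= c C1 IH [_ /IH]. Qed.

(** [I] arrives last and ends no earlier than the newest top of [C], so it prolongs the increasing
    subsequence that ends there. *)
Lemma tops_lis_push past I C : (forall J, J \in past -> J.1 <= I.1) ->
  tops_lis past C -> (forall c C', C = c :: C' -> (top_interval c).2 <= I.2) ->
  forall c, top_interval c = I -> tops_lis (rcons past I) (c :: C).
Proof.
move=> pI lisC tI c cI; split; last by exact: tops_lis_sub (subseq_rcons _ _) lisC.
case: C lisC tI => [_ _|c0 C [[q [qs qo qn]] _] /(_ _ _ erefl) t0].
  exists [::]; split=> //; rewrite sub1seq cI mem_rcons mem_head //.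
exists (rcons q (top_interval c0)); split; last by rewrite size_rcons qn.
  by rewrite cI -!cats1; apply: cat_subseq; rewrite ?cats1.
rewrite cI; case: q qs qo qn => [|a q] /= qs qo qn.
  rewrite /= andbT /le_interv t0 andbT pI //.
  by move: qs; rewrite sub1seq.
rewrite rcons_path qo last_rcons /le_interv t0 andbT pI //.
by apply: (mem_subseq qs); rewrite inE mem_rcons mem_head orbT.
Qed.

(* Both ways of placing the interval I: on a fresh chain (with [c = [::]] and
   [C1 = [::]]) or on top of the chain c. *)
Definition placed I C C1 c C2 : Prop :=
  [/\ C = C1 ++ (if c is [::] then [::] else [:: c]) ++ C2,
      c = [::] -> C1 = [::],
      all (fun c' => I.2 < (top_interval c').2) C1,
      all (fun c' => (top_interval c').2 < I.2) C2 &
      c != [::] -> I.2 <= (top_interval c).2].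

Lemma placed_new I past s : invB past s -> (forall J, J \in past -> J.1 <= I.1) ->
  ~~ has (top_contains I) (chains s) -> placed I (chains s) [::] [::] (chains s).
Proof.
move=> inv pI /hasPn nc; split=> //; apply/allP => c cs.
have := nc _ cs; have := allP (inv_nonempty inv) _ cs.
case: c cs => [//|[J d] c] cs _ /=; rewrite /contains negb_and -!ltNge.
case/orP => //; rewrite ltNge pI // -(perm_mem (inv_perm inv)).
by apply/mapP; exists (J, d) => //; apply/flattenP; exists ((J, d) :: c); rewrite ?mem_head.
Qed.

Lemma tops_gt C1 C2 c :
  sorted (fun c c' => (top_interval c').2 < (top_interval c).2) (C1 ++ c :: C2) ->
  all (fun c' => (top_interval c).2 < (top_interval c').2) C1 /\
  all (fun c' => (top_interval c').2 < (top_interval c).2) C2.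
Proof.
rewrite (sorted_pairwise (rev_trans _)); last by move=> a b d /=; apply: lt_trans.
rewrite pairwise_cat /= => /and3P[/allrelP ac _ /andP[cC2 _]]; split=> //.
by apply/allP => c' c'C; apply: ac; rewrite ?mem_head.
Qed.

(** Past intervals start no later than [I], so a top contains [I] as soon as it ends no earlier. As
    the right ends of the tops decrease along the list, the best chain separates the tops that end
    after [I] from those that end before. *)
Lemma placed_best I past s C1 J d c C2 :
  invB past s -> (forall J, J \in past -> J.1 <= I.1) ->
  chains s = C1 ++ ((J, d) :: c) :: C2 -> best_chain I C1 J d c C2 ->
  placed I (chains s) C1 ((J, d) :: c) C2.
Proof.
move=> inv pI sE [/andP[JI IJ] best].
have := inv_tops inv; rewrite sE => /tops_gt[/= g1 g2]; split=> //.
  by apply: sub_all g1 => c' /=; apply: le_lt_trans.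
apply/allP => c' c'C2; have /allP/(_ _ c'C2) := g2.
have c's : c' \in chains s by rewrite sE mem_cat inE c'C2 !orbT.
have := allP (inv_nonempty inv) _ c's.
case: c' c'C2 c's => [//|[J' d'] c'] c'C2 c's _ /= lt.
rewrite ltNge; apply/negP => IJ'; have : J.2 <= J'.2.
  apply: (best _ d' c'); first by rewrite mem_cat inE c'C2 !orbT.
  rewrite /contains IJ' andbT pI // -(perm_mem (inv_perm inv)).
  by apply/mapP; exists (J', d') => //; apply/flattenP; exists ((J', d') :: c'); rewrite ?mem_head.
by rewrite leNgt lt.
Qed.

Lemma flatten_placed I C C1 c C2 d : placed I C C1 c C2 ->
  perm_eq (flatten (C1 ++ ((I, d) :: c) :: C2)) ((I, d) :: flatten C).
Proof.
move=> [-> _ _ _ _]; have -> : flatten (C1 ++ (if c is [::] then [::] else [:: c]) ++ C2)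
    = flatten C1 ++ c ++ flatten C2.
  by rewrite flatten_cat; case: c.
by rewrite flatten_cat /= -(cat1s (I, d)) perm_catCA.
Qed.

Lemma chain_ends_ge c J d : chain_ok ((J, d) :: c) ->
  forall p, p \in (J, d) :: c -> J.2 <= p.1.2.
Proof.
move=> /= /and3P[_ /allP leJ _] p; rewrite inE => /orP[/eqP->//|]; exact: leJ.
Qed.

(** The part of the invariant that does not involve [times], common to the three kinds of step. The
    hypothesis on the colors of [c] is what lets [d] come on top. *)
Lemma placed_structure past s I C1 c C2 d :
  invB past s -> (forall J, J \in past -> J.1 <= I.1) ->
  placed I (chains s) C1 c C2 ->
  all (fun p => (p.2 == d) || (h <= count_color p.2 c)%N) c ->
  let C' := C1 ++ ((I, d) :: c) :: C2 in
  [/\ perm_eq [seq p.1 | p <- flatten C'] (rcons past I), all chain_ok C',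
      all (fun c => c != [::]) C',
      sorted (fun c c' => (top_interval c').2 < (top_interval c).2) C' &
      tops_lis (rcons past I) C'].
Proof.
move=> inv pI pl cd C'; have [sE c0 g1 g2 gc] := pl.
have [okC neC srC lisC] :=
  And4 (inv_chain inv) (inv_nonempty inv) (inv_tops inv) (inv_lis inv).
split.
- apply: perm_trans (perm_map _ (flatten_placed d pl)) _.
  by rewrite perm_sym perm_rcons perm_sym /= perm_cons (inv_perm inv).
- move: okC; rewrite sE !all_cat /= => /and3P[-> okc ->]; rewrite andbT /= cd andbT.
  case: c okc gc {pl sE C' c0 cd} => [//|[J dJ] c]; rewrite /= andbT => okc /(_ isT) IJ.
  have ge := chain_ends_ge okc; move: okc => /= -> /=; rewrite IJ /=.
  by apply/allP => p pc; apply: le_trans IJ (ge _ _); rewrite inE pc orbT.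
- by move: neC; rewrite sE !all_cat /= => /and3P[-> _ ->].
- have tr : transitive (fun c c' => (top_interval c').2 < (top_interval c).2).
    by move=> b a e /= ba eb; apply: lt_trans eb ba.
  move: srC; rewrite sE !(sorted_pairwise tr) !pairwise_cat /=.
  case/and3P=> _ -> /and3P[_ _ ->]; rewrite g2 !andbT.
  apply/allrelP => a b aC; rewrite inE => /orP[/eqP->/=|bC].
    exact: (allP g1).
  by apply: lt_trans (allP g2 _ bC) (allP g1 _ aC).
- have lis2 : tops_lis past C2 by move: lisC; rewrite sE => /tops_lis_drop/tops_lis_drop.
  have new : tops_lis (rcons past I) (((I, d) :: c) :: C2).
    apply: tops_lis_push => // c1 C1' C2E; apply: ltW; apply: (allP g2).
    by rewrite C2E mem_head.
  rewrite /C'; case: c c0 sE new {gc cd pl C'} => [/(_ erefl) ->//|p c] _ sE new.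
  apply: (@tops_lis_replace _ C1 (p :: c)) new; rewrite /= in sE; rewrite -sE.
  exact: tops_lis_sub (subseq_rcons _ _) lisC.
Qed.

(** [times s] stays correct: [I] ends no later than [J], which already has color [d], so the largest
    right end of this color does not change. *)
Lemma inv_same_color past s I C1 J d c C2 :
  invB past s -> (forall J, J \in past -> J.1 <= I.1) ->
  placed I (chains s) C1 ((J, d) :: c) C2 ->
  invB (rcons past I)
    (StateB (C1 ++ ((I, d) :: (J, d) :: c) :: C2) (times s) (ncol s)).
Proof.
move=> inv pI pl.
have Js : ((J, d) :: c) \in chains s by have [-> _ _ _ _] := pl; rewrite mem_cat mem_head orbT.
have JF : (J, d) \in flatten (chains s) by apply/flattenP; exists ((J, d) :: c); rewrite ?mem_head.
have [|a1 a2 a3 a4 a5] := @placed_structure _ _ _ _ _ _ d inv pI pl.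
  have := allP (inv_chain inv) _ Js => /= /and3P[_ _ cd]; rewrite eqxx /=.
  apply: sub_all cd => p /orP[->//|hc]; apply/orP; right.
  by apply: leq_trans hc _; rewrite leq_addl.
have mF := perm_mem (flatten_placed d pl).
have IJ : I.2 <= J.2 by have [_ _ _ _ /(_ isT)] := pl.
split=> //=; [exact: inv_uniq inv|exact: inv_size inv|exact: inv_times_le inv|..].
- by move=> p; rewrite mF inE => /orP[/eqP->/=|]; [exact: (inv_color_le inv JF)|exact: (inv_color_le inv)].
- move=> p q; rewrite mF inE => /orP[/eqP->/= qD dq|]; last exact: (inv_end_le inv).
  by apply: le_trans IJ _; exact: (inv_end_le inv JF qD).
- move=> q /(inv_witness inv)[p [pF pq pe]]; exists p; split=> //.
  by rewrite mF inE pF orbT.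
Qed.

(** Every color of [c] is saturated, so any color may come on top. A reused color has all its
    intervals ended before [I.1], so [I.2] becomes its largest right end. *)
Lemma inv_bottom past s I C1 c C2 d D' chi' :
  invB past s -> (forall J, J \in past -> J.1 <= I.1) -> I.1 <= I.2 ->
  placed I (chains s) C1 c C2 ->
  all (fun p => (h <= count_color p.2 c)%N) c ->
  bottom_color (times s) (ncol s) I d D' chi' ->
  invB (rcons past I) (StateB (C1 ++ ((I, d) :: c) :: C2) D' chi').
Proof.
move=> inv pI I12 pl hc bc.
have [|a1 a2 a3 a4 a5] := @placed_structure _ _ _ _ _ _ d inv pI pl.
  by apply: sub_all hc => p ->; rewrite orbT.
have mF := perm_mem (flatten_placed d pl).
case: bc mF a1 a2 a3 a4 a5 => [noD|D1 D2 {}d y DE yI] mF a1 a2 a3 a4 a5; split=> //=.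
- rewrite (inv_uniq inv) andbT; apply/mapP => -[p pD pE].
  by have := inv_times_le inv pD; rewrite -pE ltnn.
- by rewrite (inv_size inv).
- by move=> p; rewrite inE => /orP[/eqP->//|/(inv_times_le inv)/leqW].
- by move=> p; rewrite mF inE => /orP[/eqP->//|/(inv_color_le inv)/leqW].
- move=> p q; rewrite mF !inE => /orP[/eqP->|pF] /orP[/eqP->|qD] //=.
  + by move=> E; have := inv_times_le inv qD; rewrite -E ltnn.
  + by move=> E; have := inv_color_le inv pF; rewrite E ltnn.
  + exact: (inv_end_le inv).
- move=> q; rewrite inE => /orP[/eqP->|/(inv_witness inv)[p [pF pq pe]]].
    by exists (I, (ncol s).+1); rewrite mF mem_head.
  by exists p; rewrite mF inE pF orbT.
- by have := inv_uniq inv; rewrite DE !map_cat.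
- by rewrite -(inv_size inv) DE !size_cat.
- have le := inv_times_le inv; move=> p pD; have : (p.1 \in map fst (times s)).
    have -> : map fst (times s) = map fst (D1 ++ (d, I.2) :: D2) by rewrite DE !map_cat.
    exact: map_f.
  by case/mapP=> p' /le + ->.
- have dD : (d, y) \in times s by rewrite DE mem_cat mem_head orbT.
  move=> p; rewrite mF inE => /orP[/eqP->/=|/(inv_color_le inv)//].
  exact: (inv_times_le inv dD).
- have dD : (d, y) \in times s by rewrite DE mem_cat mem_head orbT.
  have yI2 : y <= I.2 by apply: ltW; apply: lt_le_trans yI I12.
  have := inv_uniq inv; rewrite DE map_cat /= cat_uniq /= => /and3P[_ /norP[dD1 _] /andP[dD2 _]].
  move=> p q; rewrite mF inE mem_cat inE => /orP[/eqP->|pF] /or3P[qD|/eqP->|qD] //=.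
  + by move=> E; case/negP: dD1; rewrite E; apply: map_f.
  + by move=> E; case/negP: dD2; rewrite E; apply: map_f.
  + by apply: (inv_end_le inv) => //; rewrite DE mem_cat qD.
  + by move=> pd; apply: le_trans yI2; apply: (inv_end_le inv pF dD).
  + by apply: (inv_end_le inv) => //; rewrite DE mem_cat inE qD !orbT.
- move=> q; rewrite mem_cat inE => /or3P[qD|/eqP->|qD].
  + have /(inv_witness inv)[p [pF pq pe]] : q \in times s by rewrite DE mem_cat qD.
    by exists p; rewrite mF inE pF orbT.
  + by exists (I, d); rewrite mF mem_head.
  + have /(inv_witness inv)[p [pF pq pe]] : q \in times s by rewrite DE mem_cat inE qD !orbT.
    by exists p; rewrite mF inE pF orbT.
Qed.

Lemma chain_counts J d c : chain_ok ((J, d) :: c) ->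
  (h <= count_color d ((J, d) :: c))%N ->
  all (fun p => (h <= count_color p.2 ((J, d) :: c))%N) ((J, d) :: c).
Proof.
move=> /= /and3P[_ _ cd] hd; rewrite hd /=; apply: sub_all cd => p /orP[/eqP->//|hp].
by apply: leq_trans hp _; rewrite leq_addl.
Qed.

Lemma stepB_inv past s I d s' :
  invB past s -> (forall J, J \in past -> J.1 <= I.1) -> I.1 <= I.2 ->
  stepB h s I d s' -> invB (rcons past I) s'.
Proof.
move=> inv pI I12 st; case: st => {s'} [{}d D' chi' nc bc|C1 J {}d c C2 sE best lt|
  C1 J dJ c C2 {}d D' chi' sE best ge bc].
- exact: (inv_bottom inv pI I12 (placed_new inv pI nc)).
- exact: (inv_same_color inv pI (placed_best inv pI sE best)).
- apply: (inv_bottom inv pI I12 (placed_best inv pI sE best)) bc.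
  apply: chain_counts ge; apply: (allP (inv_chain inv)).
  by rewrite sE mem_cat mem_head orbT.
Qed.

Definition covers t J : bool := J.1 <= t <= J.2.

(** Only a new color raises the counter, and then every recorded time is at least [I.1], so
    [times_bound] applies at [I.1]. All past intervals have started by then, so being alive means
    covering [I.1]. *)
Lemma bottom_color_bound k past s I d D' chi' : (0 < h)%N ->
  invB past s -> (forall J, J \in past -> J.1 <= I.1) ->
  (count (covers I.1) past < h * k)%N -> (ncol s <= k + size (chains s))%N ->
  bottom_color (times s) (ncol s) I d D' chi' -> (chi' <= k + size (chains s))%N.
Proof.
move=> h0 inv pI cnt nk; case=> {d D' chi'} // noD.
have : (h * ncol s <= count (alive I.1) past + h * size (chains s))%N.
  by apply: times_bound inv _ => p /noD; rewrite -leNgt.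
have -> : count (alive I.1) past = count (covers I.1) past.
  by apply: eq_in_count => J /pI JI; rewrite /covers JI.
move=> H; have : (h * ncol s < h * (k + size (chains s)))%N by rewrite mulnDr; lia.
by rewrite ltn_pmul2l.
Qed.

Lemma runB_bound k past s Is ds s' : (0 < h)%N ->
  invB past s -> sorted (fun I J => I.1 <= J.1) (past ++ Is) ->
  all (fun J => J.1 <= J.2) Is ->
  (forall t, (count (covers t) (past ++ Is) <= h * k)%N) ->
  (ncol s <= k + size (chains s))%N -> runB h s Is ds s' ->
  invB (past ++ Is) s' /\ (ncol s' <= k + size (chains s'))%N.
Proof.
move=> h0; elim: Is past s ds => [|I Is IH] past s [|d ds] //=.
  by move=> inv _ _ _ nk ->; rewrite cats0.
move=> inv srt /andP[I12 Is12] cnt nk [s1 [st run]].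
have pI J : J \in past -> J.1 <= I.1.
  move: srt; rewrite (sorted_pairwise); last by move=> a b e; exact: le_trans.
  by rewrite pairwise_cat => /and3P[/allrelP H _ _] Jp; apply: H; rewrite ?mem_head.
have inv1 := stepB_inv inv pI I12 st.
rewrite -cat_rcons in srt cnt *; apply: IH run => //.
(* [I] covers [I.1] as well and is not yet in [past]: the inequality is strict, which leaves room
   for one more color. *)
have cntI : (count (covers I.1) past < h * k)%N.
  apply: leq_trans (cnt I.1); rewrite count_cat -cats1 count_cat /=.
  by rewrite /covers lexx I12 /=; lia.
case: st => [d' D' chi' nc bc|C1 J d' c C2 sE best lt|
  C1 J dJ c C2 d' D' chi' sE best ge bc] /=.
- by rewrite addnS leqW //; apply: (bottom_color_bound h0 inv pI cntI nk bc).
- by move: nk; rewrite sE !size_cat.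
- have := bottom_color_bound h0 inv pI cntI nk bc.
  by rewrite sE !size_cat.
Qed.

Lemma inv_lis_chains past s : invB past s ->
  exists q, [/\ subseq q past, sorted le_interv q & size q = size (chains s)].
Proof.
move=> /inv_lis; case: (chains s) => [_|c C [[q [a b e]] _]].
  by exists [::]; rewrite sub0seq.
by exists (rcons q (top_interval c)); rewrite size_rcons e.
Qed.

End AlgorithmB.

(** * The random-access machine *)

Section Machine.
Variable R : realType.
Implicit Types (m : memory R) (Q : memory R -> Prop) (c : cmd).

(** A weakest precondition with a time budget: the rules below execute a program symbolically while
    consuming the budget. *)
Definition wp k c m Q : Prop := exists t m', [/\ exec c m t m', (t <= k)%N & Q m'].

Lemma wp_mono k k' c m Q Q' : (k <= k')%N -> (forall m', Q m' -> Q' m') ->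
  wp k c m Q -> wp k' c m Q'.
Proof.
by move=> kk QQ [t [m' [e tk q]]]; exists t, m'; split; [|apply: leq_trans kk|apply: QQ].
Qed.

Lemma wp_skip k m Q : Q m -> wp k.+1 Skip m Q.
Proof. by exists 1%N, m; split=> //; constructor. Qed.

Lemma wp_word k a e1 e2 m Q :
  Q (set_word m a (Defs.eval m e1) (Defs.eval m e2)) -> wp k.+1 (SetWord a e1 e2) m Q.
Proof. by move=> q; exists 1%N; eexists; split; [constructor| |exact: q]. Qed.

Lemma wp_real k a e1 b e2 m Q :
  Q (set_real m a (Defs.eval m e1) (reals m b (Defs.eval m e2))) ->
  wp k.+1 (SetReal a e1 b e2) m Q.
Proof. by move=> q; exists 1%N; eexists; split; [constructor| |exact: q]. Qed.

Lemma wp_seq k1 k2 c1 c2 m Q : wp k1 c1 m (fun m1 => wp k2 c2 m1 Q) ->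
  wp (k1 + k2) (Seq c1 c2) m Q.
Proof.
move=> [t1 [m1 [e1 l1 [t2 [m2 [e2 l2 q]]]]]]; exists (t1 + t2)%N, m2.
by split; [econstructor; [exact: e1|exact: e2]|exact: leq_add|].
Qed.

Lemma wp_seq_word k a e1 e2 c m Q :
  wp k c (set_word m a (Defs.eval m e1) (Defs.eval m e2)) Q ->
  wp k.+1 (Seq (SetWord a e1 e2) c) m Q.
Proof. by move=> w; apply: (@wp_seq 1); apply: wp_word. Qed.

Lemma wp_seq_real k a e1 b e2 c m Q :
  wp k c (set_real m a (Defs.eval m e1) (reals m b (Defs.eval m e2))) Q ->
  wp k.+1 (Seq (SetReal a e1 b e2) c) m Q.
Proof. by move=> w; apply: (@wp_seq 1); apply: wp_real. Qed.

Lemma wp_if k b c1 c2 m Q : (holds m b -> wp k c1 m Q) ->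
  (~~ holds m b -> wp k c2 m Q) -> wp k.+1 (If b c1 c2) m Q.
Proof.
move=> H1 H2; have [hb|hb] := boolP (holds m b).
  by have [t [m' [e l q]]] := H1 hb; exists t.+1, m'; split=> //; apply: ExecIfTrue.
by have [t [m' [e l q]]] := H2 hb; exists t.+1, m'; split=> //; apply: ExecIfFalse.
Qed.

(** The index of [Inv] bounds the number of iterations left. Each costs at most [k] steps and one
    test, and the failing test is the last unit. *)
Lemma wp_while (Inv : nat -> memory R -> Prop) k b c :
  (forall f m, Inv f m -> holds m b ->
    exists2 f', f = f'.+1 & wp k c m (Inv f')) ->
  forall f m, Inv f m ->
    wp (f * k.+1).+1 (While b c) m (fun m' => (exists f', Inv f' m') /\ ~~ holds m' b).
Proof.
move=> step; elim=> [|f IH] m i; have [hb|hb] := boolP (holds m b).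
- by have [] := step _ _ i hb.
- by exists 1%N, m; split; [constructor| |split=> //; exists 0%N].
- have [_ [<-] [t1 [m1 [e1 l1 i1]]]] := step _ _ i hb.
  have [t2 [m2 [e2 l2 q]]] := IH _ i1; exists (t1 + t2).+1, m2.
  by split=> //; [apply: ExecWhileTrue e1 e2|rewrite mulSn; lia].
- by exists 1%N, m; split; [constructor| |split=> //; exists f.+1].
Qed.

Definition var a : expr := Word a (Const 0).
Definition twice e : expr := Add e e.
Definition succ e : expr := Add e (Const 1).

(* Memory layout.  Words: 0: capacity; 1: output color; 2: number of chains;
   3: number of colors; 4, 5: color of the top of each chain and number of its
   intervals of this color; 6, 7: winning leaf and color in the tournament tree;
   8, 9, 10, 11: loop variables.
   Reals: 0: arriving interval; 1: right ends of the tops, in increasing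
   order; 2: keys of the tree, in heap order, with leaves N, ..., 2N - 1. *)
Definition search_cmd : cmd :=
  Seq (SetWord 8 (Const 0) (Const 0))
  (Seq (SetWord 9 (Const 0) (var 2))
  (While (LtWord (var 8) (var 9))
    (Seq (SetWord 10 (Const 0) (Half (Add (var 8) (var 9))))
    (If (LtReal 1 (var 10) 0 (Const 1))
      (SetWord 8 (Const 0) (succ (var 10)))
      (SetWord 9 (Const 0) (var 10)))))).

(** Word 8 finally holds the number of tops that end before [y]: the index of the best chain if it
    is less than [L], the first free index otherwise. *)
Lemma search_spec f m (y := reals m 0 1) (L := words m 2 0) : (L < 2 ^ f)%N ->
  (forall i j, (i < j < L)%N -> reals m 1 i < reals m 1 j) ->
  wp (f * 4 + 3) search_cmd m (fun m' =>
    [/\ reals m' = reals m,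
        forall a i, a \notin [:: 8; 9; 10]%N -> words m' a i = words m a i,
        (words m' 8 0 <= L)%N,
        forall i, (i < words m' 8 0)%N -> reals m 1 i < y &
        forall i, (words m' 8 0 <= i < L)%N -> y <= reals m 1 i]).
Proof.
move=> Lf srt; rewrite addn3; do 2![apply: wp_seq_word].
(* The gap between [lo] and [hi] is below [2 ^ f] and each round halves it, so [f] rounds
   suffice. *)
pose Inv f m' := let lo := words m' 8 0 in let hi := words m' 9 0 in
  [/\ reals m' = reals m,
      forall a i, a \notin [:: 8; 9; 10]%N -> words m' a i = words m a i,
      [/\ (lo <= hi)%N, (hi <= L)%N & (hi < 2 ^ f + lo)%N],
      forall i, (i < lo)%N -> reals m 1 i < y &
      forall i, (hi <= i < L)%N -> y <= reals m 1 i].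
have step g m' : Inv g m' -> holds m' (LtWord (var 8) (var 9)) ->
    exists2 g', g = g'.+1 &
    wp 3 (Seq (SetWord 10 (Const 0) (Half (Add (var 8) (var 9))))
    (If (LtReal 1 (var 10) 0 (Const 1))
      (SetWord 8 (Const 0) (succ (var 10)))
      (SetWord 9 (Const 0) (var 10)))) m' (Inv g').
  move=> [rE wE [lohi hiL hif] lo_lt hi_ge] /= lt.
  case: g hif => [|g] hif; first by exfalso; lia.
  exists g => //; apply: (@wp_seq_word 2); rewrite /=.
  set mid := _./2; have mE : mid = half (words m' 8 0 + words m' 9 0) by [].
  have midE := odd_double_half (words m' 8 0 + words m' 9 0); rewrite -mE -muln2 in midE.
  rewrite expnS in hif; set o := odd _ in midE.
  have o1 : (o <= 1)%N by case: o {midE}.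
  have [lm mh] : (words m' 8 0 <= mid)%N /\ (mid < words m' 9 0)%N by lia.
  apply: wp_if => /=; rewrite /upd /= rE => c.
    apply: wp_word; split=> /=.
    - exact: rE.
    - by move=> a i a8; rewrite /upd;
        move: (a8); rewrite !inE !negb_or => /and3P[/negbTE-> _ /negbTE->]; exact: wE.
    - rewrite /upd /=; split; lia.
    - rewrite /upd /= addn1 => i; rewrite ltnS leq_eqVlt => /orP[/eqP->//|im].
      by apply: lt_trans c; apply: srt; rewrite im; lia.
    - by rewrite /upd /=.
  apply: wp_word; split=> /=.
  - exact: rE.
  - by move=> a i a8; rewrite /upd;
      move: (a8); rewrite !inE !negb_or => /and3P[_ /negbTE-> /negbTE->]; exact: wE.
  - rewrite /upd /=; split; lia.
  - by rewrite /upd /=.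
  - rewrite /upd /= => i; rewrite leq_eqVlt => /andP[/orP[/eqP<- _|mi iL]].
      by rewrite leNgt.
    apply: ltW; move: c; rewrite -leNgt => c; apply: le_lt_trans c _.
    by apply: srt; rewrite mi.
apply: (wp_mono _ _ (wp_while step _)) => [|m' [[g [rE wE [lohi hiL hif] lo_lt hi_ge]]]|].
- exact: leqnn.
- rewrite /= -leqNgt => hl; have E : words m' 8 0 = words m' 9 0 by lia.
  by split=> //; rewrite E.
- split=> //=; rewrite /upd /=.
  + by move=> a i; rewrite !inE !negb_or => /and3P[/negbTE-> /negbTE-> _].
  + by split=> //; rewrite addn0.
  + by move=> i; rewrite -/L; lia.
Qed.

Definition node_ok m k : Prop :=
  [/\ reals m 2 k <= reals m 2 k.*2, reals m 2 k <= reals m 2 k.*2.+1 &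
      exists2 j, j \in [:: k.*2; k.*2.+1] &
        reals m 2 k = reals m 2 j /\ words m 6 k = words m 6 j].

(** For every [N], the nodes [N], ..., [2N - 1] are the leaves of the heap-ordered binary tree with
    inner nodes [1], ..., [N - 1], so the tree can grow by one leaf at a time. *)
Definition tree_ok N m : Prop :=
  (forall k, (0 < k < N)%N -> node_ok m k) /\
  (forall j, (N <= j < N.*2)%N -> words m 6 j = j).

(** The winning leaf is traced by induction from the leaves to the root, and the minimality of the
    root key by induction from the root to the leaves. *)
Lemma tree_root N m : (0 < N)%N -> tree_ok N m ->
  [/\ (N <= words m 6 1 < N.*2)%N, reals m 2 1 = reals m 2 (words m 6 1) &
      forall j, (N <= j < N.*2)%N -> reals m 2 1 <= reals m 2 j].
Proof.
move=> N0 [ok leaf].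
have win k : (0 < k < N.*2)%N ->
    (N <= words m 6 k < N.*2)%N /\ reals m 2 k = reals m 2 (words m 6 k).
  have [b] := ubnP (N.*2 - k)%N; elim: b k => // b IH k kb /andP[k0 kN].
  have [Nk|kN'] := leqP N k; first by rewrite leaf ?Nk.
  have [|_ _ [j jk [-> ->]]] := ok k; first by rewrite k0.
  by apply: IH; move: jk; rewrite !inE => /orP[]/eqP->; lia.
have mn k : (0 < k < N.*2)%N -> reals m 2 1 <= reals m 2 k.
  elim/ltn_ind: k => k IH /andP[k0 kN]; have [->//|k1] := eqVneq k 1%N.
  have := odd_double_half k; have [kE|kE] := boolP (odd k) => /= E.
    have [|_ le _] := ok k./2; first lia.
    have kE2 : k./2.*2.+1 = k by lia.
    rewrite kE2 in le; apply: le_trans le; apply: IH; lia.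
  have [|le _ _] := ok k./2; first lia.
  have kE2 : k./2.*2 = k by lia.
  rewrite kE2 in le; apply: le_trans le; apply: IH; lia.
have [|a b] := win 1%N; first lia.
by split=> // j jN; apply: mn; lia.
Qed.

Definition update_cmd : cmd :=
  While (LtWord (Const 1) (var 11))
    (Seq (SetWord 11 (Const 0) (Half (var 11)))
    (If (LtReal 2 (succ (twice (var 11))) 2 (twice (var 11)))
      (Seq (SetReal 2 (var 11) 2 (succ (twice (var 11))))
           (SetWord 6 (var 11) (Word 6 (succ (twice (var 11))))))
      (Seq (SetReal 2 (var 11) 2 (twice (var 11)))
           (SetWord 6 (var 11) (Word 6 (twice (var 11))))))).

(* The node conditions are local, so only the parent of the current node can be
   violated. *)
Lemma update_spec f N m : (0 < words m 11 0 < N.*2)%N -> (N.*2 <= 2 ^ f.+1)%N ->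
  (forall k, (0 < k < N)%N -> k != (words m 11 0)./2 -> node_ok m k) ->
  (forall j, (N <= j < N.*2)%N -> words m 6 j = j) ->
  wp (f * 5 + 1) update_cmd m (fun m' =>
    [/\ tree_ok N m',
        forall a i, a \notin [:: 6; 11]%N -> words m' a i = words m a i,
        forall a i, a != 2%N -> reals m' a i = reals m a i &
        forall i, (N <= i)%N -> reals m' 2 i = reals m 2 i]).
Proof.
move=> jN Nf ok leaf.
pose Inv f m' := [/\ [/\ (0 < words m' 11 0 < N.*2)%N & (words m' 11 0 < 2 ^ f.+1)%N],
  forall k, (0 < k < N)%N -> k != (words m' 11 0)./2 -> node_ok m' k,
  forall j, (N <= j < N.*2)%N -> words m' 6 j = j,
  forall a i, a \notin [:: 6; 11]%N -> words m' a i = words m a i &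
  (forall a i, a != 2%N -> reals m' a i = reals m a i) /\
  forall i, (N <= i)%N -> reals m' 2 i = reals m 2 i].
rewrite addn1 /update_cmd; set b := LtWord _ _; set c := Seq _ _.
have step g m' : Inv g m' -> holds m' b -> exists2 g', g = g'.+1 & wp 4 c m' (Inv g').
  move=> [[j0 jg] okm lf wE [rE r2E]] /= j1.
  case: g jg => [|g] jg; first by exfalso; move: jg; rewrite expn1; lia.
  exists g => //; rewrite /c; apply: (@wp_seq_word 3).
  set m1 := set_word _ _ _ _.
  have m1E : words m1 11 0 = (words m' 11 0)./2 by [].
  have half_lt : ((words m' 11 0)./2 < 2 ^ g.+1)%N by move: jg; rewrite expnS; lia.
  have [q q0 qE] : exists2 q, (0 < q < N)%N & words m1 11 0 = q.
    by exists (words m' 11 0)./2 => //; lia.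
  (* Both branches of the test copy the winning child [e] into its parent [q]; afterwards only the
     parent of [q] can be wrong. *)
  have main e : e \in [:: q.*2; q.*2.+1] -> reals m' 2 e <= reals m' 2 q.*2 ->
      reals m' 2 e <= reals m' 2 q.*2.+1 ->
      Inv g (set_word (set_real m1 2 q (reals m1 2 e)) 6 q (words m1 6 e)).
    move=> eq le1 le2; have eq' : (e == q) = false.
      by move: eq; rewrite !inE => /orP[]/eqP->; apply/negbTE; lia.
    have q2 : (q.*2 == q) = false by apply/negbTE; lia.
    have q21 : (q.*2.+1 == q) = false by apply/negbTE; lia.
    split=> /=.
    - by rewrite /upd /=; split; lia.
    - move=> k kN kq.
      have [->|nk] := eqVneq k q.
        rewrite /node_ok /= /upd /= eqxx /= q2 q21.
        by split=> //; exists e => //; rewrite eq' /=.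
      have {kq}kq : k != q./2 by move: kq; rewrite /upd /= -m1E qE.
      have [||a1 a2 [j jk [a3 a4]]] := okm k; [by []|by rewrite -m1E qE|].
      have k2 : (k.*2 == q) = false by apply/negbTE; lia.
      have k21 : (k.*2.+1 == q) = false by apply/negbTE; lia.
      have jq : (j == q) = false by move: jk; rewrite !inE => /orP[]/eqP->.
      rewrite /node_ok /= /upd /= (negbTE nk) k2 k21 /=; split=> //.
      by exists j => //; rewrite jq.
    - move=> j jN'; rewrite /upd /=; have -> : (j == q) = false by apply/negbTE; lia.
      exact: lf.
    - move=> a i a6; rewrite /upd /=; move: (a6); rewrite !inE negb_or => /andP[/negbTE-> /negbTE->].
      exact: wE.
    - split=> [a i a2|i Ni]; rewrite /upd.
        by rewrite (negbTE a2) /=; exact: rE.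
      have -> : (i == q) = false by apply/negbTE; lia.
      by rewrite andbF; exact: r2E.
  apply: (@wp_if 2) => /=; rewrite -[upd _ _ _ _ 11 0]/(words m1 11 0) qE addn1 addnn.
    move=> lt; apply: (@wp_seq_real 1); apply: wp_word => /=.
    rewrite -[upd _ _ _ _ 11 0]/(words m1 11 0) qE addn1 addnn.
    by apply: main; rewrite ?inE ?eqxx ?orbT // ltW.
  rewrite -leNgt => lt; apply: (@wp_seq_real 1); apply: wp_word => /=.
  rewrite -[upd _ _ _ _ 11 0]/(words m1 11 0) qE addnn.
  by apply: main; rewrite ?inE ?eqxx ?lexx.
apply: (wp_mono _ _ (wp_while step (f := f) _)) => //.
- move=> m' [[g [[j0 _] okm lf wE [rE r2E]]]] /=; rewrite -leqNgt => j1.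
  split=> //; split=> // k kN; apply: okm => //.
  (* At the root the exceptional index is [1./2 = 0], which is not an inner node: every node is
     correct. *)
  have j1E : words m' 11 0 = 1%N by lia.
  by rewrite j1E; lia.
- by split=> //; split=> //; lia.
Qed.


End Machine.

(** * Colors and their times as the leaves of the tournament tree *)

Section Coloring.
Variable R : realType.
Implicit Types (m : memory R).

Lemma perm_replace (T : eqType) (D1 D2 E1 E2 : seq T) x y :
  perm_eq (D1 ++ x :: D2) (E1 ++ x :: E2) -> perm_eq (D1 ++ y :: D2) (E1 ++ y :: E2).
Proof.
by move=> /permP H; apply/permP => a; have := H a; rewrite !count_cat /=; lia.
Qed.

Definition leaf_seq m N := [seq (words m 7 j, reals m 2 j) | j <- iota N N].

(** The leaves agree with [D] up to order only, since a leaf moves when the tree grows; this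
    suffices because a reused pair may stand anywhere in [D]. *)
Definition tree_rel m D N : Prop :=
  [/\ words m 3 0 = N, perm_eq D (leaf_seq m N) & tree_ok N m].

Definition reuse_cmd : cmd :=
  Seq (SetWord 11 (Const 0) (Word 6 (Const 1)))
  (Seq (SetReal 2 (var 11) 0 (Const 1))
  (SetWord 1 (Const 0) (Word 7 (var 11)))).

(* The leaf N becomes an inner node, with the old leaf and the new one below. *)
Definition fresh_cmd : cmd :=
  Seq (SetReal 2 (twice (var 3)) 2 (var 3))
  (Seq (SetWord 6 (twice (var 3)) (twice (var 3)))
  (Seq (SetWord 7 (twice (var 3)) (Word 7 (var 3)))
  (Seq (SetReal 2 (succ (twice (var 3))) 0 (Const 1))
  (Seq (SetWord 6 (succ (twice (var 3))) (succ (twice (var 3))))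
  (Seq (SetWord 7 (succ (twice (var 3))) (succ (var 3)))
  (Seq (SetWord 11 (Const 0) (succ (twice (var 3))))
  (Seq (SetWord 3 (Const 0) (succ (var 3)))
  (SetWord 1 (Const 0) (var 3))))))))).

Definition color_cmd : cmd :=
  Seq (If (And (LtWord (Const 0) (var 3)) (LtReal 2 (Const 1) 0 (Const 0)))
        reuse_cmd fresh_cmd)
    update_cmd.

(** The situation between the choice of a color and the repair of the tree: only the parent of the
    leaf named in word 11 may be wrong. *)
Definition unfinished m D N m1 : Prop :=
  exists d D' N', [/\ bottom_color D N (reals m 0 0, reals m 0 1) d D' N',
    [/\ words m1 3 0 = N', words m1 1 0 = d, perm_eq D' (leaf_seq m1 N') &
        (N' <= N.+1)%N],
    (0 < words m1 11 0 < N'.*2)%N,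
    (forall k, (0 < k < N')%N -> k != (words m1 11 0)./2 -> node_ok m1 k) /\
    (forall j, (N' <= j < N'.*2)%N -> words m1 6 j = j) &
    (forall a i, a \notin [:: 1; 3; 6; 7; 11]%N -> words m1 a i = words m a i) /\
    (forall a i, a != 2%N -> reals m1 a i = reals m a i)].

Lemma reuse_spec m D N : tree_rel m D N -> (0 < N)%N ->
  reals m 2 1 < reals m 0 0 -> wp 3 reuse_cmd m (unfinished m D N).
Proof.
move=> [m3 pD ok] N0 lt; have [pN keyE _] := tree_root N0 ok.
have [nok leaf] := ok.
apply: wp_seq_word; apply: wp_seq_real; apply: wp_word; rewrite /= /upd /=.
set p := words m 6 1 in pN keyE *.
have iE : iota N N = iota N (p - N) ++ p :: iota p.+1 (N.*2 - p.+1).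
  have -> : N = ((p - N) + (N.*2 - p.+1).+1)%N :> nat by lia.
  by rewrite [in LHS](iotaD _ (p - N)) /=; congr (iota _ _ ++ _ :: iota _ _); lia.
have pinD : (words m 7 p, reals m 2 p) \in D.
  by rewrite (perm_mem pD); apply: (map_f (fun j => (words m 7 j, reals m 2 j))); rewrite mem_iota; lia.
move: (pinD) pD => /splitPr[D1 D2] pD.
exists (words m 7 p), (D1 ++ (words m 7 p, reals m 0 1) :: D2), N; split.
- by apply: BottomReuse; [reflexivity|rewrite -keyE].
- split=> //; rewrite /leaf_seq /= /upd /=.
  have eqm i n : (p \notin iota i n) ->
      [seq (words m 7 j, if j == p then reals m 0 1 else reals m 2 j) | j <- iota i n] =
      [seq (words m 7 j, reals m 2 j) | j <- iota i n].
    move=> pn; apply/eq_in_map => j ji; case: eqVneq ji pn => // ->.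
    by move=> ->.
  move: pD; rewrite /leaf_seq iE !map_cat /= eqxx !eqm ?mem_iota; try lia.
  exact: perm_replace.
- by rewrite /= /upd /=; lia.
- split=> [k kN kp|j jN]; last by rewrite /= /upd /= leaf.
  move: kp; rewrite /= /upd /= => kp.
  have [//|a1 a2 [j jk [a3 a4]]] := nok k.
  have kp1 : (k == p) = false by apply/negbTE; lia.
  have kp2 : (k.*2 == p) = false by apply/negbTE; lia.
  have kp3 : (k.*2.+1 == p) = false by apply/negbTE; lia.
  have jp : (j == p) = false by move: jk; rewrite !inE => /orP[]/eqP->.
  rewrite /node_ok /= /upd /= kp1 kp2 kp3 /=; split=> //.
  by exists j => //; rewrite jp.
- split=> a i; rewrite /= /upd /=.
    by rewrite !inE !negb_or => /and5P[/negbTE-> _ _ _ /negbTE->].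
  by move=> /negbTE->.
Qed.

Lemma fresh_spec m D N : tree_rel m D N ->
  (forall p, p \in D -> ~~ (p.2 < reals m 0 0)) ->
  wp 9 fresh_cmd m (unfinished m D N).
Proof.
move=> [m3 pD ok] noD; have [nok leaf] := ok.
apply: wp_seq_real; do 2![apply: wp_seq_word]; apply: wp_seq_real.
do 4![apply: wp_seq_word]; apply: wp_word.
rewrite /= /upd /= ?eqxx !m3 !addnn !addn1.
have e2 : (N.*2 == N.*2.+1) = false by apply/negbTE; lia.
have e2' : (N.*2.+1 == N.*2) = false by apply/negbTE; lia.
exists N.+1, ((N.+1, reals m 0 1) :: D), N.+1; split.
- exact: BottomNew.
- split=> //; rewrite /leaf_seq.
  (* For the first color, node 0 is copied onto itself, outside the tree, whose only node is then
     the leaf 1. *)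
  have [N0|N0] := posnP N.
    by move: pD; rewrite N0 /leaf_seq /= /upd /= => /perm_nilP->.
  have -> : iota N.+1 N.+1 = iota N.+1 N.-1 ++ [:: N.*2; N.*2.+1].
    rewrite -{2}(ltn_predK N0) -addn2 iotaD /=.
    by congr (_ ++ [:: _; _]); lia.
  have eqm i n : (i + n <= N.*2)%N ->
      [seq (if j == N.*2.+1 then N.+1 else if j == N.*2 then words m 7 N else words m 7 j,
            if j == N.*2.+1 then reals m 0 1 else if j == N.*2 then reals m 2 N else reals m 2 j) | j <- iota i n] =
      [seq (words m 7 j, reals m 2 j) | j <- iota i n].
    move=> le; apply/eq_in_map => j; rewrite mem_iota => ji.
    by have [-> ->] : (j == N.*2.+1) = false /\ (j == N.*2) = false by split; apply/negbTE; lia.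
  rewrite map_cat /= /upd /= e2 !eqxx /= eqm; last lia.
  have iE : iota N N = N :: iota N.+1 N.-1 by rewrite -{2}(ltn_predK N0).
  move: pD; rewrite /leaf_seq iE /= => /permP pD.
  by apply/permP => a; have := pD a; rewrite !count_cat /=; lia.
- by rewrite /= /upd /=; lia.
- split=> [k kN kp|j jN].
    have kN' : (k < N)%N by move: kp; rewrite /= /upd /= => kp; lia.
    have [|a1 a2 [j jk [a3 a4]]] := nok k; first lia.
    have ne i : (i < N.*2)%N -> (i == N.*2.+1) = false /\ (i == N.*2) = false.
      by move=> iN; split; apply/negbTE; lia.
    have [|k1 k2] := ne k; first lia.
    have [|k3 k4] := ne k.*2; first lia.
    have [|k5 k6] := ne k.*2.+1; first lia.
    have [|j1 j2] := ne j; first by move: jk; rewrite !inE => /orP[]/eqP->; lia.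
    rewrite /node_ok /= /upd /= k1 k2 k3 k4 k5 k6; split=> //.
    by exists j => //; rewrite j1 j2.
  rewrite /= /upd /=; case: eqVneq => [//|n1]; case: eqVneq => [//|n2].
  by apply: leaf; lia.
- split=> a i; rewrite /= /upd /=.
    by rewrite !inE !negb_or => /and5P[/negbTE-> /negbTE-> /negbTE-> /negbTE-> /negbTE->].
  by move=> /negbTE->.
Qed.

Lemma color_spec f m D N : tree_rel m D N -> (N < 2 ^ f)%N ->
  wp (f * 5 + 11) color_cmd m (fun m' => exists d D' N',
    [/\ bottom_color D N (reals m 0 0, reals m 0 1) d D' N', tree_rel m' D' N',
        words m' 1 0 = d,
        forall a i, a \notin [:: 1; 3; 6; 7; 11]%N -> words m' a i = words m a i &
        forall a i, a != 2%N -> reals m' a i = reals m a i]).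
Proof.
move=> rel Nf; have [m3 pD ok] := rel.
have -> : (f * 5 + 11 = 10 + (f * 5 + 1))%N by lia.
apply: wp_seq; apply: (@wp_mono _ 10 _ _ _ (unfinished m D N)) => // [m1|]; last first.
  apply: (@wp_if _ 9) => /=; rewrite m3.
    by move=> /andP[N0 lt]; apply: wp_mono (reuse_spec rel N0 lt).
  move=> ge; apply: fresh_spec rel _ => p pD'; apply/negP => lt.
  have N0 : (0 < N)%N.
    by move: pD'; rewrite (perm_mem pD); case: posnP => // ->.
  case/negP: ge; rewrite N0 /=; apply: le_lt_trans lt.
  move: pD'; rewrite (perm_mem pD) => /mapP[j]; rewrite mem_iota => jN ->.
  by have [_ _] := tree_root N0 ok; apply; rewrite /=; lia.
move=> [d [D' [N' [bc [w3 w1 pD' N'N] jN [nok leaf] [wE rE]]]]].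
have Nf' : (N'.*2 <= 2 ^ f.+1)%N by rewrite expnS; lia.
apply: wp_mono (update_spec jN Nf' nok leaf) => // m2 [tree wE' rE' keyE].
exists d, D', N'; split=> //.
- split=> //; first by rewrite wE'.
  rewrite /leaf_seq in pD' *; congr (perm_eq _ _): pD'; apply/eq_in_map => j.
  by rewrite mem_iota => /andP[jN' _]; rewrite wE' // keyE.
- by rewrite wE'.
- move=> a i a1; rewrite wE' ?wE //; move: a1; rewrite !inE !negb_or.
  by case/and5P=> _ _ -> _ ->.
- by move=> a i a2; rewrite rE' ?rE.
Qed.

End Coloring.

(** * Processing one arrival on the machine *)

Section OnlineStep.
Variable R : realType.
Implicit Types (m : memory R) (I J : interv R) (c : chain R) (C : seq (chain R)).
Implicit Types (s : stateB R) (past Is : seq (interv R)).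

Definition top_color c : nat := if c is (_, d) :: _ then d else 0%N.

(** Of each chain the machine stores only what a step reads about its top. The list [C] has the
    newest chain first and the arrays the oldest, hence [rev]. *)
Definition chain_rel m C : Prop :=
  words m 2 0 = size C /\
  forall k, (k < size C)%N -> let c := nth [::] (rev C) k in
    [/\ reals m 1 k = (top_interval c).2, words m 4 k = top_color c &
        words m 5 k = count_color (top_color c) c].

Lemma chain_rel_frame m m' C :
  (forall a i, a \in [:: 2; 4; 5]%N -> words m' a i = words m a i) ->
  (forall i, reals m' 1 i = reals m 1 i) -> chain_rel m C -> chain_rel m' C.
Proof.
move=> wE rE [L rel]; split=> [|k kC /=]; first by rewrite wE.
by rewrite rE !wE //; apply: rel.
Qed.

Lemma tree_rel_frame m m' D N :
  (forall a i, a \in [:: 3; 6; 7]%N -> words m' a i = words m a i) ->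
  (forall i, reals m' 2 i = reals m 2 i) -> tree_rel m D N -> tree_rel m' D N.
Proof.
move=> wE rE [L pD [nok leaf]]; split; first by rewrite wE.
  congr (perm_eq _ _): pD; apply/eq_map => j.
  by rewrite rE wE.
split=> [k /nok[a1 a2 [j jk [a3 a4]]]|j jN]; last by rewrite wE // leaf.
by split; rewrite ?rE //; exists j => //; rewrite !rE !wE.
Qed.

Definition opt_chain c : seq (chain R) := if c is [::] then [::] else [:: c].

(** The index of a chain in memory is the number of older chains, so [size C2] is the place to write
    whether an old chain is extended or a new one created. *)
Lemma chain_rel_push m m' C C1 c C2 I d :
  C = C1 ++ opt_chain c ++ C2 -> (c = [::] -> C1 = [::]) -> chain_rel m C ->
  words m' 2 0 = size (C1 ++ ((I, d) :: c) :: C2) ->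
  (forall k, k != size C2 -> [/\ reals m' 1 k = reals m 1 k,
     words m' 4 k = words m 4 k & words m' 5 k = words m 5 k]) ->
  reals m' 1 (size C2) = I.2 -> words m' 4 (size C2) = d ->
  words m' 5 (size C2) = count_color d ((I, d) :: c) ->
  chain_rel m' (C1 ++ ((I, d) :: c) :: C2).
Proof.
move=> CE c0 [_ rel] L same e1 e2 e3; split=> //= k.
rewrite size_cat /= => kC; rewrite rev_cat rev_cons cat_rcons nth_cat size_rev.
have [k2|k2|->] := ltngtP k (size C2); last by rewrite subnn /= e1 e2 e3.
  have [|-> -> ->] := same k; first by rewrite neq_ltn k2.
  have := rel k; rewrite CE !rev_cat -catA nth_cat size_rev k2; apply.
  by rewrite !size_cat; lia.
have [|-> -> ->] := same k; first by rewrite neq_ltn k2 orbT.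
case: c c0 CE kC {e1 e2 e3 L} => [/(_ erefl) ->|p c _ CE kC].
  by rewrite /=; lia.
have := rel k; rewrite CE rev_cat /= rev_cons cat_rcons nth_cat size_rev /=.
have -> : (k < size C2)%N = false by lia.
case E : (k - size C2)%N => [|i]; first lia.
by rewrite /=; apply; rewrite size_cat /=.
Qed.

Definition same_cmd : cmd :=
  Seq (SetReal 1 (var 8) 0 (Const 1))
  (Seq (SetWord 5 (var 8) (succ (Word 5 (var 8))))
  (SetWord 1 (Const 0) (Word 4 (var 8)))).

Definition push_cmd : cmd :=
  Seq (If (LtWord (var 8) (var 2)) Skip (SetWord 2 (Const 0) (succ (var 2))))
  (Seq (SetReal 1 (var 8) 0 (Const 1))
  (Seq (SetWord 4 (var 8) (var 1))
  (SetWord 5 (var 8) (Const 1)))).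

Definition step_cmd : cmd :=
  Seq search_cmd
  (If (And (LtWord (var 8) (var 2)) (LtWord (Word 5 (var 8)) (var 0)))
    same_cmd (Seq color_cmd push_cmd)).

(** A new color occurs nowhere, and the intervals of a reused color ended before [I] starts, while
    those of [c] end no earlier than [I]. Hence the counter of the top color restarts at 1. *)
Lemma fresh_color_count h past s I C1 c C2 d D' chi' :
  invB h past s -> I.1 <= I.2 -> placed I (chains s) C1 c C2 ->
  bottom_color (times s) (ncol s) I d D' chi' -> count_color d c = 0%N.
Proof.
move=> inv I12 [sE _ _ _ cI] bc; apply/eqP; rewrite -leqn0 leqNgt -has_count.
apply/hasPn => p pc; apply/eqP => pd.
have c0 : c != [::] by case: c pc {sE cI}.
have cs : c \in chains s.
  by rewrite sE; case: c c0 {pc sE cI} => // ? ? _; rewrite mem_cat mem_head orbT.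
have pF : p \in flatten (chains s) by apply/flattenP; exists c.
case: bc pd => [_|D1 D2 {}d y DE yI] pd.
  by have := inv_color_le inv pF; rewrite pd ltnn.
have dD : (d, y) \in times s by rewrite DE mem_cat mem_head orbT.
have := inv_end_le inv pF dD pd; rewrite leNgt => /negP; apply.
apply: lt_le_trans yI _; apply: le_trans I12 (le_trans (cI c0) _).
case: c c0 pc cs {sE cI pF} => [//|[J e] c] _ pc cs.
by apply: (chain_ends_ge (h := h)) pc; apply: (allP (inv_chain inv)).
Qed.

Lemma push_spec m (k := words m 8 0) (L := words m 2 0) : (k <= L)%N ->
  wp 5 push_cmd m (fun m' =>
    [/\ words m' 2 0 = maxn L k.+1,
        forall i, i != k -> [/\ reals m' 1 i = reals m 1 i,
          words m' 4 i = words m 4 i & words m' 5 i = words m 5 i],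
        [/\ reals m' 1 k = reals m 0 1, words m' 4 k = words m 1 0 &
            words m' 5 k = 1%N],
        forall a i, a \notin [:: 2; 4; 5]%N -> words m' a i = words m a i &
        forall a i, a != 1%N -> reals m' a i = reals m a i]).
Proof.
move=> kL; have step m1 : reals m1 = reals m ->
    (forall a i, a != 2%N -> words m1 a i = words m a i) ->
    words m1 2 0 = maxn L k.+1 ->
    wp 3 (Seq (SetReal 1 (var 8) 0 (Const 1)) (Seq (SetWord 4 (var 8) (var 1))
      (SetWord 5 (var 8) (Const 1)))) m1 (fun m' =>
    [/\ words m' 2 0 = maxn L k.+1,
        forall i, i != k -> [/\ reals m' 1 i = reals m 1 i,
          words m' 4 i = words m 4 i & words m' 5 i = words m 5 i],
        [/\ reals m' 1 k = reals m 0 1, words m' 4 k = words m 1 0 &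
            words m' 5 k = 1%N],
        forall a i, a \notin [:: 2; 4; 5]%N -> words m' a i = words m a i &
        forall a i, a != 1%N -> reals m' a i = reals m a i]).
  move=> rE wE w2; apply: wp_seq_real; apply: wp_seq_word; apply: wp_word.
  rewrite /= /upd /= rE (wE 8%N) // (wE 1%N) // -/k; split=> //=.
  - by move=> i /negbTE ik; rewrite ik !wE.
  - by rewrite eqxx.
  - move=> a i; rewrite !inE !negb_or => /and3P[a2 /negbTE-> /negbTE->] /=.
    by rewrite wE.
  - by move=> a i /negbTE->.
apply: (@wp_seq _ 2 3); apply: wp_if => /= lt.
  by apply: wp_skip; apply: step => //; rewrite -/k -/L in lt *; lia.
apply: wp_word; apply: step => //= [a i /negbTE a2|].
  by rewrite /upd a2.
by rewrite /upd /= -/L; rewrite -/k -/L in lt; lia.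
Qed.

Definition state_rel h m s : Prop :=
  [/\ words m 0 0 = h, chain_rel m (chains s) & tree_rel m (times s) (ncol s)].

(** There are at most as many chains, and as many colors, as past intervals, so the same [f] bounds
    the binary search and the climb in the tree. *)
Lemma step_spec f h past s m I :
  invB h past s -> (forall J, J \in past -> J.1 <= I.1) -> I.1 <= I.2 ->
  state_rel h m s -> reals m 0 0 = I.1 -> reals m 0 1 = I.2 ->
  (size past < 2 ^ f)%N ->
  wp (f * 9 + 20) step_cmd m (fun m' => exists d s',
    [/\ stepB h s I d s', words m' 1 0 = d & state_rel h m' s']).
Proof.
move=> inv pI I12 [mh crel trel] mx my szf.
have [L rel] := crel.
have szL : (size (chains s) <= size past)%N.
  by have [q [qs _ <-]] := inv_lis_chains inv; exact: size_subseq.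
have szN : (ncol s <= size past)%N.
  rewrite -(perm_size (inv_perm inv)) size_map -(size_map (@snd _ _)).
  rewrite -(inv_size inv) -(size_map (@fst _ _) (times s)); apply: uniq_leq_size (inv_uniq inv) _.
  move=> d /mapP[q /(inv_witness inv)[p [pF pq _]] ->].
  by rewrite -pq; apply: map_f.
have topE k : (k < size (chains s))%N ->
    reals m 1 k = (top_interval (nth [::] (chains s) (size (chains s) - k.+1))).2.
  by move=> kC; have [-> _ _] := rel _ kC; rewrite nth_rev.
have srt i j : (i < j < words m 2 0)%N -> reals m 1 i < reals m 1 j.
  rewrite L => ij; rewrite !topE; try lia.
  have tr : transitive (fun c c' : chain R => (top_interval c').2 < (top_interval c).2).
    by move=> b a e /= ba eb; apply: lt_trans eb ba.
  have := sorted_ltn_nth tr [::] (inv_tops inv); apply; rewrite ?inE; lia.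
(* Search takes [4f + 3] steps, the test 1, coloring [5f + 11] and the push 5. *)
have -> : (f * 9 + 20 = (f * 4 + 3) + (f * 5 + 17))%N by lia.
have Lf : (words m 2 0 < 2 ^ f)%N by rewrite L; lia.
apply: wp_seq; apply: (wp_mono (leqnn _) _ (search_spec Lf srt)) => m1.
set k := words m1 8 0; move=> [rE wE kL lo hi]; rewrite L in kL hi.
have crel1 : chain_rel m1 (chains s).
  by apply: chain_rel_frame crel => [a i a2|i]; rewrite ?rE // wE //;
    move: a2; rewrite !inE => /or3P[]/eqP->.
have trel1 : tree_rel m1 (times s) (ncol s).
  by apply: tree_rel_frame trel => [a i a2|i]; rewrite ?rE // wE //;
    move: a2; rewrite !inE => /or3P[]/eqP->.
have m1h : words m1 0 0 = h by rewrite wE.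
have m1L : words m1 2 0 = size (chains s) by rewrite wE.
have Nf : (ncol s < 2 ^ f)%N by lia.
(* Common to the two cases that require a bottom color: a new chain, with [c = [::]], and a chain
   whose top color is saturated. *)
have bottom C1 c C2 : placed I (chains s) C1 c C2 -> size C2 = k ->
    (forall d D' chi', bottom_color (times s) (ncol s) I d D' chi' ->
      stepB h s I d (StateB (C1 ++ ((I, d) :: c) :: C2) D' chi')) ->
    wp (f * 5 + 16) (Seq color_cmd push_cmd) m1 (fun m' => exists d s',
      [/\ stepB h s I d s', words m' 1 0 = d & state_rel h m' s']).
  move=> pl C2k st; have -> : (f * 5 + 16 = (f * 5 + 11) + 5)%N by lia.
  apply: wp_seq; apply: (wp_mono (leqnn _) _ (color_spec trel1 Nf)) => m2.
  rewrite rE mx my -surjective_pairing => -[d [D' [N' [bc trel2 w1 wE2 rE2]]]].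
  have kE : words m2 8 0 = k by rewrite wE2.
  have w2 : words m2 2 0 = size (chains s) by rewrite wE2.
  apply: (wp_mono (leqnn _) _ (push_spec (m := m2) _)); last by rewrite kE w2.
  rewrite kE w2 => m3 [L3 other [y3 d3 c3] wE3 rE3].
  exists d, (StateB (C1 ++ ((I, d) :: c) :: C2) D' N'); split.
  - exact: st.
  - by rewrite wE3.
  split=> /=.
  - by rewrite wE3 // wE2.
  - have [sE c0 _ _ _] := pl.
    apply: (chain_rel_push (m := m1) sE c0 crel1); rewrite ?C2k ?y3 ?d3 ?c3 ?w1 //.
    + rewrite L3 sE !size_cat /= -C2k; case: c c0 {pl st sE c3} => [/(_ erefl) ->|p c _] /=; lia.
    + by move=> i ik; have [-> -> ->] := other i ik; rewrite rE2 // rE !wE2.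
    + by rewrite rE2 // my.
    + by rewrite /= eqxx (fresh_color_count inv I12 pl bc).
  - by apply: tree_rel_frame trel2 => [a i a2|i]; rewrite ?rE3 // wE3 //;
    move: a2; rewrite !inE => /or3P[]/eqP->.
(* Tops at smaller indices end before [I], and those at larger indices end after the top at index
   [k], so this one is the best. *)
have split_at : (k < size (chains s))%N -> exists C1 J d c C2,
    [/\ chains s = C1 ++ ((J, d) :: c) :: C2, size C2 = k,
        best_chain I C1 J d c C2 &
        words m1 4 k = d /\ words m1 5 k = count_color d ((J, d) :: c)].
  move=> kC; set i := (size (chains s) - k.+1)%N.
  have iC : (i < size (chains s))%N by rewrite /i; lia.
  have [e3 e4 e5] := crel1.2 _ kC; rewrite nth_rev // -/i in e3 e4 e5.
  have CE : chains s = take i (chains s) ++ nth [::] (chains s) i :: drop i.+1 (chains s).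
    by rewrite -drop_nth // cat_take_drop.
  have := allP (inv_nonempty inv) _ (mem_nth [::] iC).
  case E : (nth _ _ _) e3 e4 e5 CE => [//|[J d] c] /= e3 e4 e5 CE _.
  exists (take i (chains s)), J, d, c, (drop i.+1 (chains s)); split=> //.
    by rewrite size_drop /i; lia.
  split.
    rewrite /contains -e3 rE -my hi ?leqnn // andbT; apply: pI.
    rewrite -(perm_mem (inv_perm inv)); apply/mapP; exists (J, d) => //.
    by apply/flattenP; exists ((J, d) :: c); rewrite ?mem_head // -E mem_nth.
  have srtC := inv_tops inv; rewrite CE in srtC; have [/= g1 _] := tops_gt srtC.
  move=> J' d' c'; rewrite mem_cat inE => /or3P[c'C _|/eqP[-> _ _] //|].
    by have /ltW := allP g1 _ c'C.
  have arith1 j n : (k < n -> j < n - (n - k.+1).+1 ->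
      n - (k - j.+1).+1 = (n - k.+1).+1 + j)%N by lia.
  have arith2 j n : (k < n -> j < n - (n - k.+1).+1 -> k - j.+1 < k)%N by lia.
  move=> /(nthP [::])[j]; rewrite size_drop nth_drop => jC c'E /andP[_].
  have := lo (k - j.+1)%N; rewrite topE; last lia.
  have -> : (size (chains s) - (k - j.+1).+1 = i.+1 + j)%N.
    exact: (arith1 _ _ kC jC).
  by rewrite c'E /= my => lt; rewrite leNgt lt //; apply: (arith2 _ _ kC jC).
rewrite addnS; apply: wp_if; rewrite /= -/k m1L m1h; last first.
  move=> cond; have [kC|Ck] := ltnP k (size (chains s)); last first.
    have kE : k = size (chains s) by lia.
    have nc : ~~ has (top_contains I) (chains s).
      apply/hasPn => c cs; case: c cs => [//|[J d] c] cs /=; rewrite /contains negb_and -!ltNge.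
      apply/orP; right; have iC := cs; rewrite -index_mem in iC; set i := index _ _ in iC.
      have arith3 n : (i < n -> n - i.+1 < n)%N by lia.
      have := lo (size (chains s) - i.+1)%N; rewrite (topE _ (arith3 _ iC)).
      have arith1 n : (i < n -> n - (n - i.+1).+1 = i)%N by lia.
      have arith2 n : (i < n -> k = n -> n - i.+1 < k)%N by lia.
      rewrite (arith1 _ iC) nth_index //= my; apply; exact: arith2 iC kE.
    apply: (bottom [::] [::] (chains s)) => //; first exact: placed_new inv pI nc.
    by move=> d D' chi' bc; apply: StepNewChain.
  have [C1 [J [d [c [C2 [sE C2k best [_ c5]]]]]]] := split_at kC.
  rewrite kC c5 /= -leqNgt in cond.
  apply: (bottom C1 ((J, d) :: c) C2 (placed_best inv pI sE best) C2k) => d' D' chi' bc.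
  exact: StepBottom sE best cond bc.
move=> /andP[kC cnt]; have [C1 [J [d [c [C2 [sE C2k best [d4 c5]]]]]]] := split_at kC.
apply: (@wp_mono _ 3 _ _ _ _ _ _ (fun m' H => H)); first lia.
apply: wp_seq_real; apply: wp_seq_word; apply: wp_word.
exists d, (StateB (C1 ++ ((I, d) :: (J, d) :: c) :: C2) (times s) (ncol s)); split.
- by apply: StepSameColor sE best _; rewrite -c5.
- by rewrite /= /upd /= -/k d4.
split=> /=.
- by rewrite /upd.
- apply: (chain_rel_push (m := m1) (c := (J, d) :: c) sE _ crel1) => //=; rewrite /upd /= -/k ?C2k ?eqxx //.
  + by rewrite m1L sE !size_cat.
  + by move=> i /negbTE ->.
  + by rewrite rE my.
  + by rewrite c5 addn1 /= eqxx.
- by apply: tree_rel_frame trel1 => [a i a2|i]; rewrite /= /upd //=;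
    move: a2; rewrite !inE => /or3P[]/eqP->.
Qed.

End OnlineStep.

Lemma online_run (R : realType) (h f : nat) (b : R) (Is past : seq (interv R))
    (s : stateB R) (m : memory R) :
  invB h past s -> state_rel h m s ->
  sorted (fun I J : interv R => I.1 <= J.1) (past ++ Is) ->
  all (fun J : interv R => J.1 <= J.2) Is -> (size (past ++ Is) <= 2 ^ f)%N ->
  (f * 9 + 20)%:R <= b ->
  exists ds s', runB h s Is ds s' /\ processes step_cmd b m Is ds.
Proof.
elim: Is past s m => [|I Is IH] past s m inv rel srt /=.
  by exists [::], s.
move=> /andP[I12 Is12] szf fb.
have pI J : J \in past -> J.1 <= I.1.
  move: srt; rewrite (sorted_pairwise); last by move=> x y z; exact: le_trans.
  by rewrite pairwise_cat => /and3P[/allrelP H _ _] Jp; apply: H; rewrite ?mem_head.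
have relI : state_rel h (receive m I) s by [].
have [|t [m' [ex tf [d [s' [st w1 rel']]]]]] := step_spec (f := f) inv pI I12 relI erefl erefl.
  by apply: leq_trans szf; rewrite size_cat /=; lia.
have inv' := stepB_inv inv pI I12 st.
rewrite -cat_rcons in srt szf.
have [ds [s'' [run pr]]] := IH _ _ _ inv' rel' srt Is12 szf fb.
exists (d :: ds), s''; split; first by exists s'.
exists t, m'; split=> //; apply: le_trans fb; by rewrite ler_nat.
Qed.

Lemma ln_trunc_log (R : realType) (n : nat) : (0 < n)%N ->
  (trunc_log 2 n)%:R * ln 2 <= ln n%:R :> R.
Proof.
move=> n0; rewrite mulr_natl -lnXn // ler_ln ?posrE ?exprn_gt0 ?ltr0n //.
by rewrite -natrX ler_nat; apply: trunc_logP.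
Qed.

Lemma online_time (R : realType) : exists (p : cmd) (C : R),
  forall (h n : nat) (Is : seq (interv R)),
    (0 < h)%N -> (2 <= n)%N -> size Is = n -> valid_input Is ->
    exists (ds : seq nat) (s : stateB R),
      runB h (initB R) Is ds s /\
      processes p (C * ln n%:R) (init_memory R h) Is ds.
Proof.
(* With [l = trunc_log 2 n >= 1] and [f = l + 1], the cost [9f + 20 = 9l + 29] is at most [38 l],
   and [l * ln 2 <= ln n]. *)
exists step_cmd, (38%:R / ln 2) => h n Is h0 n2 szI [/allP pos srt _].
have n0 : (0 < n)%N by lia.
have lt2 : (n < 2 ^ (trunc_log 2 n).+1)%N by apply: trunc_log_ltn.
apply: (online_run (f := (trunc_log 2 n).+1) (initB_inv R h)) => //.
- split=> //; split=> //; split; first by case.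
  by case.
- by apply: sub_sorted srt => I J /ltW.
- by apply/allP => J /pos/ltW.
- by rewrite /= szI ltnW.
- have t1 : (1 <= trunc_log 2 n)%N by rewrite trunc_log_max.
  have l2 : 0 < ln 2 :> R by rewrite ln_gt0 // ltr1n.
  have := ln_trunc_log R n0; rewrite -ler_pdivlMr // => le.
  rewrite mulrAC -mulrA; apply: le_trans (ler_wpM2l (ler0n _ _) le).
  by rewrite -natrM ler_nat; lia.
Qed.

(** * Staircases *)

Lemma count_online (R : realType) (n : nat) (I : 'I_n -> interv R) (a : pred (interv R)) :
  count a (online_input I) = #|[set i | a (I i)]%SET|.
Proof.
rewrite /online_input count_sort count_map cardsE cardE -size_filter.
by congr size; rewrite [in RHS]/enum_mem -filter_predI; apply: eq_filter => i; rewrite /= andbT.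
Qed.

(** The intervals at [t] are sorted by their color in an optimal coloring, whose classes have at
    most [h] members there. *)
Lemma covers_opt (R : realType) (h n : nat) (I : 'I_n -> interv R) (t : R) : (0 < h)%N ->
  (count (covers t) (online_input I) <= h * opt_colors h I)%N.
Proof.
move=> /(opt_colorsP I)[[c [_ cP]] _].
rewrite count_online -sum1_card (partition_big c xpredT) //=.
rewrite mulnC -[X in (_ <= X * h)%N]card_ord -sum_nat_const.
apply: leq_sum => d _; rewrite sum1dep_card; apply: leq_trans (cP t d).
by apply: subset_leq_card; apply/fintype.subsetP => i; rewrite !inE andbC.
Qed.

Lemma run_ncol (R : realType) (h n : nat) (I : 'I_n -> interv R) ds s : (0 < h)%N ->
  (forall i, (I i).1 <= (I i).2) -> runB h (initB R) (online_input I) ds s ->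
  exists q, [/\ subseq q (online_input I), sorted (@le_interv R) q &
    (ncol s <= opt_colors h I + size q)%N].
Proof.
move=> h0 I12 run.
have [] := runB_bound (k := opt_colors h I) h0 (initB_inv R h) _ _ _ _ run => //=.
- by apply: sort_sorted => J K; apply: le_total.
- by apply/allP => J; rewrite mem_sort => /mapP[i _ ->].
- by move=> t; apply: covers_opt.
- by move=> /inv_lis_chains[q [qs qo <-]] le; exists q.
Qed.

(* F a is the highest row that an increasing sequence reaches up to column a, so
   in column a the sequence stays between F (a - 1) and F a. *)
Definition staircase (m : nat) (F : m.+1.-tuple 'I_m.+1) (ab : 'I_m.+1 * 'I_m.+1) : bool :=
  ((ab.1 == 0 :> nat) || (tnth F (inord ab.1.-1) <= ab.2)%N) && (ab.2 <= tnth F ab.1)%N.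

(* The cells of a staircase lie on distinct antidiagonals. *)
Lemma card_staircase (m : nat) (F : m.+1.-tuple 'I_m.+1) : sorted leq (map val F) ->
  (#|[set ab | staircase F ab]%SET| <= m.+1.*2)%N.
Proof.
move=> srt.
have F_mono (a b : 'I_m.+1) : (a <= b)%N -> (tnth F a <= tnth F b)%N.
  move=> ab; rewrite !(tnth_nth ord0) -!(nth_map ord0 0%N val) ?size_tuple //.
  by apply: (sorted_leq_nth leq_trans leqnn) => //; rewrite inE size_map size_tuple.
pose g (ab : 'I_m.+1 * 'I_m.+1) : 'I_m.*2.+1 := inord (ab.1 + ab.2).
have gE ab : g ab = (ab.1 + ab.2)%N :> nat.
  by rewrite inordK //; have := ltn_ord ab.1; have := ltn_ord ab.2; lia.
have lt_g ab cd : staircase F ab -> staircase F cd -> (ab.1 < cd.1)%N -> (g ab < g cd)%N.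
  move=> /andP[_ le1] /andP[+ _] lt; rewrite gtn_eqF ?(leq_ltn_trans _ lt) //= => le2.
  rewrite !gE -addSn leq_add //; apply: leq_trans le1 (leq_trans (F_mono _ _ _) le2).
  rewrite inordK; last by apply: leq_ltn_trans (leq_pred _) (ltn_ord _).
  by rewrite -ltnS prednK // (leq_ltn_trans _ lt).
apply: (@leq_trans m.*2.+1); last by lia.
rewrite -[X in (_ <= X)%N]card_ord -(@card_in_imset _ _ g) ?max_card //.
move=> ab cd; rewrite !inE => sab scd gg.
have E1 : ab.1 = cd.1.
  apply: val_inj; have [lt|lt|//] := ltngtP (val ab.1) (val cd.1).
    by have := lt_g _ _ sab scd lt; rewrite gg ltnn.
  by have := lt_g _ _ scd sab lt; rewrite gg ltnn.
have E2 : ab.2 = cd.2 by apply: val_inj; move: (gE ab); rewrite gg gE E1 => /addnI/esym.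
by rewrite (surjective_pairing ab) E1 E2 -surjective_pairing.
Qed.

Lemma sorted_staircase (R : realType) (m : nat) (g : R -> nat) (q : seq (interv R)) :
  {homo g : x y / x <= y >-> (x <= y)%N} -> (forall x, (g x < m.+1)%N) ->
  sorted (@le_interv R) q ->
  exists F : m.+1.-tuple 'I_m.+1, sorted leq (map val F) /\
    all (fun J => staircase F (inord (g J.1), inord (g J.2))) q.
Proof.
move=> g_mono gm srt.
have total J K : J \in q -> K \in q -> le_interv J K || le_interv K J.
  move=> /(nthP (0, 0))[i iq <-] /(nthP (0, 0))[j jq <-].
  have refl : reflexive (@le_interv R) by move=> I; rewrite /le_interv !lexx.
  by apply/orP; have [ij|/ltnW ji] := leqP i j; [left|right];
     apply: (sorted_leq_nth (@le_interv_trans R) refl).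
pose f (a : nat) : nat := \max_(J <- q | (g J.1 <= a)%N) g J.2.
have fm a : (f a < m.+1)%N by rewrite ltnS; apply/bigmax_leqP_seq => J _ _; rewrite -ltnS.
have f_mono a b : (a <= b)%N -> (f a <= f b)%N.
  move=> ab; apply/bigmax_leqP_seq => J Jq Ja.
  by apply: (leq_bigmax_seq (F := fun J => g J.2)) => //; apply: leq_trans ab.
have [T FE] : exists T : m.+1.-tuple 'I_m.+1, forall a, tnth T a = f a :> nat.
  by exists [tuple inord (f i) | i < m.+1] => a; rewrite tnth_mktuple inordK.
exists T; split.
  apply/(sortedP 0%N) => i; rewrite size_map size_tuple => im.
  rewrite (nth_map ord0) ?size_tuple ?(ltnW im) // (nth_map ord0) ?size_tuple //.
  have nE j : (j < m.+1)%N -> val (nth ord0 T j) = f j.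
    by move=> jm; have := FE (Ordinal jm); rewrite (tnth_nth ord0).
  by have := f_mono i i.+1 (leqnSn i); rewrite -(nE i (ltnW im)) -(nE i.+1 im).
have gi x : nat_of_ord (inord (g x) : 'I_m.+1) = g x by rewrite inordK.
apply/allP => J Jq; rewrite /staircase /= !FE !gi; apply/andP; split.
  case: posnP => //= g0; rewrite inordK; last by apply: leq_ltn_trans (leq_pred _) (gm _).
  (* [K] lies in an earlier column than [J], so [K] precedes [J] in the order and its row is not
     higher. *)
  apply/bigmax_leqP_seq => K Kq KJ; apply: (g_mono).
  have /orP[/andP[_ //]|/andP[/g_mono + _]] := total _ _ Kq Jq.
  by move: KJ g0; lia.
by apply: (leq_bigmax_seq (F := fun J => g J.2)).
Qed.

Lemma size_subseq_online (R : realType) (n : nat) (I : 'I_n -> interv R)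
    (q : seq (interv R)) (a : pred (interv R)) :
  subseq q (online_input I) -> all a q -> (size q <= #|[set i | a (I i)]%SET|)%N.
Proof. by rewrite all_count -count_online => /leq_count_subseq le /eqP <-. Qed.

(** * Rare events *)

Section UnionBound.
Context (d : measure_display) (T : measurableType d) (R : realType).
Variable mu : {measure set T -> \bar R}.

Lemma finite_union_measurable (I : finType) (Q : pred I) (B : I -> set T) :
  (forall i, Q i -> measurable (B i)) -> measurable (\bigcup_(i in [set i | Q i]) B i).
Proof. by move=> mB; apply: fin_bigcup_measurable => //; apply: finite_finset. Qed.

Lemma union_bound (I : finType) (Q : pred I) (B : I -> set T) (c : R) :
  (forall i, Q i -> measurable (B i)) -> (forall i, Q i -> (mu (B i) <= c%:E)%E) ->
  (mu (\bigcup_(i in [set i | Q i]) B i) <= (#|Q|%:R * c)%:E)%E.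
Proof.
move=> mB Bc.
have -> : [set i | Q i] = [set` enum Q].
  by apply/seteqP; split=> i /=; rewrite mem_enum.
rewrite bigcup_seq cardE; have : {in enum Q, forall i, Q i} by move=> i; rewrite mem_enum.
elim: (enum Q) => [_|i s IH sQ]; first by rewrite big_nil measure0 mul0r.
have {}IH := IH (fun j js => sQ j (mem_behead (s := i :: s) js)).
have ms : measurable (\big[setU/set0]_(j <- s) B j).
  rewrite big_seq; apply: bigsetU_measurable => j js; apply/mB/sQ.
  by rewrite inE js orbT.
have Qi : Q i by apply: sQ; rewrite mem_head.
rewrite big_cons; apply: le_trans (measureU2 _ (mB _ Qi) ms) _.
by rewrite /= -addn1 natrD mulrDl mul1r addrC EFinD leeD // Bc.
Qed.

End UnionBound.

Section Counting.
Context (d : measure_display) (T : measurableType d) (R : realType).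
Variables (P : probability T R) (mu : probability (plane R) R) (n : nat).
Variable X : 'I_n -> {RV P >-> plane R}.
Hypothesis X_iid : iid mu X.

(** A union bound over the [k]-subsets of indices: by independence, all points indexed by a given
    one fall in [A] with probability [mu A ^ k]. *)
Lemma many_in_set_bound (A : set (plane R)) (k : nat) : measurable A ->
  measurable [set w | (k <= #|[set i | X i w \in A]%SET|)%N] /\
  forall a : R, (mu A <= a%:E)%E ->
    (P [set w | (k <= #|[set i | X i w \in A]%SET|)%N] <= ('C(n, k)%:R * a ^+ k)%:E)%E.
Proof.
move=> mA; pose B (S : {set 'I_n}) := \bigcap_(i in [set` S]) (X i @^-1` A).
have mB S : measurable (B S).
  apply: fin_bigcap_measurable => [|i _]; first exact: finite_finset.
  exact: (measurable_funPTI (X i)).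
have -> : [set w | (k <= #|[set i | X i w \in A]%SET|)%N] =
    \bigcup_(S in [set S : {set 'I_n} | #|S| == k]) B S.
  apply/seteqP; split=> w /=.
    move=> kA; have : (0 < 'C(#|[set i | X i w \in A]%SET|, k))%N by rewrite bin_gt0.
    rewrite -cards_draws => /card_gt0P[S]; rewrite inE => /andP[/fintype.subsetP SA Sk].
    by exists S => // i /= /SA; rewrite inE => /set_mem.
  move=> [S /= /eqP <- BS]; apply: subset_leq_card; apply/fintype.subsetP => i iS.
  by rewrite inE; apply/mem_set; apply: BS.
split; first by apply: finite_union_measurable => S _.
move=> a Aa; rewrite -[n in 'C(n, k)]card_ord -card_draws.
have -> : #|[set S : {set 'I_n} | #|S| == k]%SET| = #|[pred S : {set 'I_n} | #|S| == k]|.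
  by apply: eq_card => S; rewrite inE.
apply: union_bound => // S /eqP <-; have [dist ind] := X_iid.
have := ind S (fun=> A) (fun=> mA); rewrite /B /= => ->.
rewrite (eq_bigr (fun=> (fine (mu A))%:E)); last first.
  by move=> i _; rewrite fineK ?fin_num_measure // -(dist i).
rewrite prodEFin prodr_const lee_fin; apply: lerXn2r; rewrite ?nnegrE.
- exact: fine_ge0.
- by rewrite -lee_fin; apply: le_trans Aa; apply: measure_ge0.
- by rewrite -lee_fin fineK ?fin_num_measure.
Qed.

End Counting.

(** * The mass of a staircase of grid cells *)

Section Grid.
Variables (R : realType) (mu : probability (plane R) R) (f : plane R -> R) (M : R).
Hypothesis mu_square : mu (`[0, 1] `*` `[0, 1]) = 1%E.
Hypothesis f_meas : measurable_fun setT f.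
Hypothesis f_bound : forall p, 0 <= f p <= M.
Hypothesis mu_density : forall A, measurable A ->
  mu A = (\int[lebesgue_measure \x lebesgue_measure]_(p in A) (f p)%:E)%E.

Lemma density_bound_ge0 : 0 <= M.
Proof. by have /andP[a b] := f_bound (0, 0); apply: le_trans b. Qed.

(** Only the traces of [A] and [B] on [[0, 1]] are controlled, since the clamped extreme cells are
    unbounded; [mu] vanishes off the unit square. *)
Lemma rectangle_le (A B : set (measurableTypeR R)) (x y e : R) : 0 < e ->
  measurable A -> measurable B ->
  A `&` `[0, 1] `<=` `[x, x + e] -> B `&` `[0, 1] `<=` `[y, y + e] ->
  (mu (A `*` B) <= (M * (e * e))%:E)%E.
Proof.
move=> e0 mA mB Ax By.
pose W : set (plane R) := `[x, x + e] `*` `[y, y + e].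
pose S : set (plane R) := `[0, 1] `*` `[0, 1].
have mi (a b : R) : measurable (`[a, b] : set (measurableTypeR R)) by exact: measurable_itv.
have mW : measurable W by apply: measurableX.
have mS : measurable S by apply: measurableX.
have muSC : mu (~` S) = 0%E by rewrite probability_setC // mu_square subee.
have le1 : (mu (A `*` B) <= mu (W `|` ~` S))%E.
  apply: le_measure; rewrite ?inE; [exact: measurableX|by apply: measurableU => //; apply: measurableC|].
  move=> [u v] /= [Au Bv]; have [[Su Sv]|] := pselect (S (u, v)); last by right.
  by left; split; [apply: Ax|apply: By].
apply: (le_trans le1); have le2 : (mu (W `|` ~` S) <= mu W + mu (~` S))%E.
  by apply: measureU2 => //; apply: measurableC.
apply: (le_trans le2); rewrite muSC adde0 mu_density //.
have fE : measurable_fun W (EFin \o f).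
  by apply/measurable_EFinP; apply: measurable_funS f_meas.
apply: (@le_trans _ _ (\int[lebesgue_measure \x lebesgue_measure]_(p in W) (cst M%:E p))%E).
  apply: ge0_le_integral => //.
  - by move=> p _; rewrite lee_fin; have /andP[] := f_bound p.
  - by move=> p _; rewrite lee_fin; have /andP[] := f_bound p.
suff WE : (lebesgue_measure \x lebesgue_measure)%E W = (e * e)%:E.
  by rewrite EFinM -WE le_eqVlt; apply/orP; left; apply/eqP; apply: integral_cst.
have len a : lebesgue_measure (`[a, a + e] : set R) = e%:E.
  by rewrite lebesgue_measure_itv /= lte_fin ltrDl e0 -EFinB [a + e]addrC addrK.
by rewrite product_measure1E // EFinM; congr (_ * _)%E; apply: len.
Qed.

Variable m : nat.

(* Clamped so that the cells cover the whole line. *)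
Definition cell (x : R) : nat := minn m (Num.truncn (x * m.+1%:R)).

Lemma cell_lt x : (cell x < m.+1)%N.
Proof. by rewrite ltnS geq_minl. Qed.

Lemma cell_homo : {homo cell : x y / x <= y >-> (x <= y)%N}.
Proof.
move=> x y xy; rewrite /cell leq_min geq_minl /= geq_min; apply/orP; right.
by apply: le_truncn; rewrite ler_wpM2r.
Qed.

Lemma cell_geE (j : nat) (x : R) : (0 < j <= m)%N -> (j <= cell x)%N = (j%:R / m.+1%:R <= x).
Proof.
by case: j => // j /andP[_ jm]; rewrite leq_min jm truncn_gt_nat ler_pdivrMr.
Qed.

Definition slab (a : nat) : set (measurableTypeR R) := [set x | cell x = a].

Lemma slab_ge_measurable j : measurable ([set x | (j <= cell x)%N] : set (measurableTypeR R)).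
Proof.
have [->|j0] := posnP j.
  by rewrite (_ : [set _ | _] = setT) //; apply/seteqP; split.
have [jm|jm] := leqP j m; last first.
  rewrite (_ : [set _ | _] = set0) //; apply/seteqP; split=> // x /=.
  by have := cell_lt x; lia.
rewrite (_ : [set _ | _] = [set` `[j%:R / m.+1%:R, +oo[]); first exact: measurable_itv.
by apply/seteqP; split=> x /=; rewrite cell_geE ?j0 // in_itv /= andbT.
Qed.

Lemma slab_measurable a : measurable (slab a).
Proof.
rewrite (_ : slab a = [set x | (a <= cell x)%N] `\` [set x | (a.+1 <= cell x)%N]).
  by apply: measurableD; apply: slab_ge_measurable.
apply/seteqP; split=> x /=; first by move=> ->; rewrite leqnn ltnn.
by move=> [le1 /negP]; rewrite -leqNgt => le2; apply/eqP; rewrite eqn_leq le2 le1.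
Qed.

Lemma slab_itv a : slab a `&` `[0, 1] `<=` `[a%:R / m.+1%:R, a%:R / m.+1%:R + m.+1%:R^-1].
Proof.
move=> x [/= xa]; rewrite !in_itv /= => /andP[x0 x1]; apply/andP; split.
  have [->|a0] := posnP a; first by rewrite mul0r.
  by rewrite -cell_geE ?xa // a0; have := cell_lt x; rewrite xa.
have -> : a%:R / m.+1%:R + m.+1%:R^-1 = a.+1%:R / m.+1%:R :> R.
  by rewrite -[a.+1]addn1 natrD mulrDl mul1r.
have [am|am] := ltnP a m.
  apply: ltW; rewrite ltNge -cell_geE ?xa ?ltnn //.
have -> : a = m by have := cell_lt x; rewrite xa; lia.
by rewrite divff // pnatr_eq0.
Qed.

(** Symmetric, because [interv_of] sorts the two coordinates of a random pair. *)
Definition box (ab : 'I_m.+1 * 'I_m.+1) : set (plane R) :=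
  (slab ab.1 `*` slab ab.2) `|` (slab ab.2 `*` slab ab.1).

Lemma box_measurable ab : measurable (box ab).
Proof. by apply: measurableU; apply: measurableX; apply: slab_measurable. Qed.

Lemma box_le ab : (mu (box ab) <= (2 * M / m.+1%:R ^+ 2)%:E)%E.
Proof.
have slabs a b : (mu (slab a `*` slab b) <= (M / m.+1%:R ^+ 2)%:E)%E.
  rewrite -exprVn expr2; apply: rectangle_le; rewrite ?invr_gt0 //.
  - exact: slab_measurable.
  - exact: slab_measurable.
  - exact: slab_itv.
  - exact: slab_itv.
apply: le_trans (measureU2 _ _ _) _; do ?[by apply: measurableX; apply: slab_measurable].
have -> : 2 * M / m.+1%:R ^+ 2 = M / m.+1%:R ^+ 2 + M / m.+1%:R ^+ 2 by ring.
by rewrite EFinD; apply: (leeD (slabs _ _) (slabs _ _)).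
Qed.

Lemma box_interv_of p : box (inord (cell (interv_of p).1), inord (cell (interv_of p).2)) p.
Proof.
rewrite /box /slab /= !inordK ?cell_lt // /interv_of /=.
by case: (leP p.1 p.2) => _; [left|right; split].
Qed.

Definition staircase_set (F : m.+1.-tuple 'I_m.+1) : set (plane R) :=
  \bigcup_(ab in [set ab | staircase F ab]) box ab.

Lemma staircase_set_measurable F : measurable (staircase_set F).
Proof. by apply: finite_union_measurable => ab _; apply: box_measurable. Qed.

Lemma staircase_set_le (F : m.+1.-tuple 'I_m.+1) : sorted leq (map val F) ->
  (mu (staircase_set F) <= (4 * M / m.+1%:R)%:E)%E.
Proof.
move=> srt; have Mge0 := density_bound_ge0.
apply: (le_trans (union_bound (c := 2 * M / m.+1%:R ^+ 2) _ _)).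
- by move=> ab _; apply: box_measurable.
- by move=> ab _; apply: box_le.
have -> : #|staircase F| = #|[set ab | staircase F ab]%SET|.
  by apply: eq_card => ab; rewrite inE.
rewrite lee_fin; apply: (@le_trans _ _ (m.+1.*2%:R * (2 * M / m.+1%:R ^+ 2))).
  apply: ler_wpM2r; last by rewrite ler_nat card_staircase.
  by rewrite divr_ge0 ?exprn_ge0 // mulr_ge0.
rewrite -muln2 natrM le_eqVlt; apply/orP; left; apply/eqP.
have : m.+1%:R != 0 :> R by rewrite pnatr_eq0.
move: (m.+1%:R : R) => N N0; field.
by [].
Qed.

End Grid.

(** * Estimates of binomial tails *)

Section Numeric.
Variable R : realType.

Lemma bin_expr_le (n k : nat) (s : R) : 0 <= s -> 'C(n, k)%:R * s ^+ k <= (1 + s) ^+ n.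
Proof.
move=> s0; have [kn|nk] := leqP k n; last by rewrite bin_small // mul0r exprn_ge0 // addr_ge0.
rewrite exprDn (bigD1 (Ordinal (kn : (k < n.+1)%N))) //= expr1n mul1r mulr_natl lerDl.
by apply: sumr_ge0 => i _; rewrite mulrn_wge0 // expr1n mul1r exprn_ge0.
Qed.

Lemma ffact_le_expn (n k : nat) : (n ^_ k <= n ^ k)%N.
Proof.
elim: k => [|k IH] //; rewrite ffactnSr expnSr.
by apply: leq_mul => //; apply: leq_subr.
Qed.

(** The weak Stirling bound [k! >= (k / e) ^ k], by induction from [(1 + 1 / k) ^ k <= e]. *)
Lemma expn_le_fact (k : nat) : k%:R ^+ k <= expR 1 ^+ k * k`!%:R :> R.
Proof.
elim: k => [|k IH]; first by rewrite !expr0 mul1r.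
have step : k.+1%:R ^+ k <= k%:R ^+ k * expR 1 :> R.
  case: k IH => [|k] _; first by rewrite !expr0 mul1r -expR0 ler_expR.
  have k0 : 0 < k.+1%:R :> R by [].
  have -> : k.+2%:R = k.+1%:R * (1 + k.+1%:R^-1) :> R.
    by rewrite mulrDr mulr1 divff ?gt_eqF // natr1.
  rewrite exprMn; apply: ler_wpM2l; first by rewrite exprn_ge0.
  have -> : expR 1 = expR (k.+1%:R^-1) ^+ k.+1 :> R.
    by rewrite -expRM_natl -mulr_natl divff // gt_eqF.
  by apply: lerXn2r; rewrite ?nnegrE ?expR_ge0 ?expR_ge1Dx // addr_ge0 // invr_ge0 ltW.
rewrite exprS factS natrM exprS.
have -> : expR 1 * expR 1 ^+ k * (k.+1%:R * k`!%:R) =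
  k.+1%:R * (expR 1 ^+ k * k`!%:R * expR 1) :> R by ring.
apply: ler_wpM2l => //; apply: le_trans step _.
by apply: ler_wpM2r; rewrite ?expR_ge0.
Qed.

(** With [k = L * N] and [n <= N ^ 2], the binomial is at most [(e * N / L) ^ k], so its product
    with the power is at most [(4 * M * e / L) ^ k]. Taking [L >= 32 * M * e] makes this at most
    [8 ^ (-N)], which absorbs the factor [4 ^ N]. *)
Lemma staircase_numeric (M : R) : 0 <= M -> exists2 L : nat, (0 < L)%N &
  forall n N : nat, (0 < N)%N -> (n <= N ^ 2)%N ->
    4 ^+ N * ('C(n, L * N)%:R * (4 * M / N%:R) ^+ (L * N)) <= 2^-1 ^+ N :> R.
Proof.
move=> M0; exists (Num.truncn (32 * M * expR 1)).+1 => // n N N0 nN.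
set L := (Num.truncn _).+1; set k := (L * N)%N.
have Le : 32 * M * expR 1 <= L%:R.
  by apply: ltW; rewrite -truncn_le_nat.
have N0R : 0 < N%:R :> R by rewrite ltr0n.
have k0 : 0 < k%:R :> R by rewrite ltr0n /k muln_gt0 N0.
have x0 : 0 <= 4 * M / N%:R by rewrite divr_ge0 // mulr_ge0.
have e0 := @expR_ge0 R 1.
have main : 'C(n, k)%:R * (4 * M / N%:R) ^+ k * k%:R ^+ k <= (k%:R / 8) ^+ k.
  apply: (@le_trans _ _ ('C(n, k)%:R * (4 * M / N%:R) ^+ k * (expR 1 ^+ k * k`!%:R))).
    by apply: ler_wpM2l; rewrite ?expn_le_fact // mulr_ge0 // exprn_ge0.
  have -> : 'C(n, k)%:R * (4 * M / N%:R) ^+ k * (expR 1 ^+ k * k`!%:R) =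
      ('C(n, k) * k`!)%:R * (4 * M / N%:R * expR 1) ^+ k :> R.
    by move: (4 * M / N%:R) => x; rewrite natrM exprMn; ring.
  rewrite bin_ffact; apply: (@le_trans _ _ ((N ^ 2)%:R ^+ k * (4 * M / N%:R * expR 1) ^+ k)).
    apply: ler_wpM2r; first by rewrite exprn_ge0 // mulr_ge0.
    rewrite -natrX ler_nat; apply: leq_trans (ffact_le_expn n k) _.
    by rewrite leq_exp2r // /k muln_gt0 N0.
  rewrite -exprMn; apply: lerXn2r; rewrite ?nnegrE.
  - by apply: mulr_ge0 => //; apply: mulr_ge0.
  - by apply: divr_ge0 => //; apply: ltW.
  rewrite natrX /k natrM.
  have -> : N%:R ^+ 2 * (4 * M / N%:R * expR 1) = N%:R * (32 * M * expR 1) / 8 :> R.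
    by field; rewrite gt_eqF.
  by rewrite ler_pM2r ?invr_gt0 // [leRHS]mulrC ler_pM2l.
have {}main : 'C(n, k)%:R * (4 * M / N%:R) ^+ k <= 8^-1 ^+ N.
  apply: (@le_trans _ _ (8^-1 ^+ k)).
    by move: main; rewrite [X in _ <= X -> _]exprMn [X in _ <= X -> _]mulrC ler_pM2r // exprn_gt0.
  by apply: ler_wiXn2l; rewrite ?invr_ge0 ?invf_le1 ?ler1n // /k leq_pmull.
apply: (@le_trans _ _ (4 ^+ N * 8^-1 ^+ N)).
  by apply: ler_wpM2l main; rewrite exprn_ge0.
rewrite -exprMn; apply: lerXn2r; rewrite ?nnegrE ?mulr_ge0 ?invr_ge0 //.
by lra.
Qed.

(** Put [s = 1 - r] and [rho = (1 + s) * r = 1 - s ^ 2]. From [C(n, j) * s ^ j <= (1 + s) ^ n] one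
    gets [C(n, j) * r ^ (n - j) * (s * r) ^ j <= rho ^ n]. If [rho ^ D' <= s * r], the last factor
    costs at most [D' * j] powers of [rho], that is, at most half of them when [D = 2 * D']. *)
Lemma clique_numeric (r : R) : 0 < r < 1 -> exists (D : nat) (rho : R),
  [/\ (0 < D)%N, 0 < rho < 1 & forall n : nat,
    'C(n, n - n %/ D)%:R * r ^+ (n - n %/ D) <= rho ^+ n./2].
Proof.
move=> /andP[r0 r1]; pose s := 1 - r; pose rho := (1 + s) * r.
have s0 : 0 < s by rewrite /s subr_gt0.
have rho0 : 0 < rho by rewrite /rho mulr_gt0 // addr_gt0.
have rho1 : rho < 1.
  have : 0 < s * s by rewrite mulr_gt0.
  by rewrite /rho /s; lra.
have sr0 : 0 < s * r by rewrite mulr_gt0.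
have [D' D'0 rD] : exists2 D' : nat, (0 < D')%N & rho ^+ D' <= s * r.
  have /cvgrPdist_lt/(_ _ sr0) : (rho ^+ k @[k --> \oo] --> (0 : R)).
    by apply: cvg_expr; rewrite gtr0_norm.
  move=> [k _ /(_ k.+1 (leqnSn k))] /=; rewrite sub0r normrN => lt.
  by exists k.+1 => //; apply: ltW; apply: le_lt_trans lt; rewrite ler_norm.
exists (D'.*2), rho; split; [by rewrite double_gt0|by rewrite rho0|] => n.
set j := (n %/ D'.*2)%N.
have jn : (j <= n)%N by rewrite leq_div.
have D'j : (D' * j <= n - n./2)%N.
  have : (j * D'.*2 <= n)%N by rewrite leq_trunc_div.
  lia.
rewrite bin_sub //.
have key : 'C(n, j)%:R * r ^+ (n - j) * rho ^+ (D' * j) <= rho ^+ (n - D' * j) * rho ^+ (D' * j).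
  rewrite -exprD subnK; last by apply: leq_trans D'j (leq_subr _ _).
  apply: (@le_trans _ _ ('C(n, j)%:R * r ^+ (n - j) * (s * r) ^+ j)).
    apply: ler_wpM2l; first by rewrite mulr_ge0 // exprn_ge0 // ltW.
    by rewrite exprM; apply: lerXn2r; rewrite ?nnegrE ?exprn_ge0 // ltW.
  have -> : 'C(n, j)%:R * r ^+ (n - j) * (s * r) ^+ j = 'C(n, j)%:R * s ^+ j * r ^+ n.
    have -> : r ^+ n = r ^+ (n - j) * r ^+ j by rewrite -exprD subnK.
    rewrite exprMn; move: (r ^+ (n - j)) (s ^+ j) (r ^+ j) => x y z; ring.
  rewrite /rho exprMn; apply: ler_wpM2r; first by rewrite exprn_ge0 // ltW.
  by apply: bin_expr_le; apply: ltW.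
apply: (@le_trans _ _ (rho ^+ (n - D' * j))).
  by move: key; rewrite ler_pM2r // exprn_gt0.
apply: ler_wiXn2l; rewrite ?ltW //.
lia.
Qed.

End Numeric.

(** * The two exceptional events *)

Section RareEvents.
Variables (R : realType) (mu : probability (plane R) R).
Hypothesis mu_pdf : bounded_pdf_on_unit_square mu.

Lemma long_chain_rare : exists2 L : nat, (0 < L)%N &
  forall (n N : nat) (d : measure_display) (T : measurableType d)
    (P : probability T R) (X : 'I_n -> {RV P >-> plane R}),
  (0 < N)%N -> (n <= N ^ 2)%N -> iid mu X ->
  exists bad : set T, [/\ measurable bad, (P bad <= (2^-1 ^+ N)%:E)%E &
    forall w, ~ bad w -> forall q : seq (interv R),
      subseq q (online_input (fun i => interv_of (X i w))) ->
      sorted (@le_interv R) q -> (size q < L * N)%N].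
Proof.
have [mu1 [f [M [f_meas f_bound density]]]] := mu_pdf.
have M0 := density_bound_ge0 f_bound.
have [L L0 num] := staircase_numeric M0; exists L => // n [//|m] d T P X _ nN X_iid.
pose k := (L * m.+1)%N.
pose Q : pred (m.+1.-tuple 'I_m.+1) := fun F => sorted leq (map val F).
pose B (F : m.+1.-tuple 'I_m.+1) := [set w | (k <= #|[set i | X i w \in (staircase_set F : set (plane R))]%SET|)%N].
have mB F : measurable (B F).
  by have [] := many_in_set_bound X_iid k (staircase_set_measurable F).
exists (\bigcup_(F in [set F | Q F]) B F); split.
- exact: finite_union_measurable.
- apply: (le_trans (union_bound
    (c := 'C(n, k)%:R * (4 * M / m.+1%:R) ^+ k) _ _)) => // [F srt|].
    have [_] := many_in_set_bound X_iid k (staircase_set_measurable F); apply.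
    exact: (staircase_set_le mu1 f_meas f_bound density).
  rewrite lee_fin; apply: le_trans (num n m.+1 isT nN); apply: ler_wpM2r.
    by rewrite mulr_ge0 // exprn_ge0 // divr_ge0 // mulr_ge0.
  (* The nondecreasing tuples are counted by a binomial coefficient, one term in the expansion of
     [(1 + 1) ^ (2m + 1)]. *)
  have -> : #|Q| = 'C(m.+1 + m, m.+1).
    by rewrite -card_sorted_tuples; apply: eq_card => F; rewrite inE.
  rewrite -natrX ler_nat -[4%N]/(2 ^ 2)%N -expnM.
  apply: (@leq_trans (2 ^ (m.+1 + m))); last by rewrite leq_exp2l //; lia.
  rewrite -(ler_nat R); have := @bin_expr_le R (m.+1 + m) m.+1 1 ler01.
  by rewrite expr1n mulr1 natrX.
- move=> w nbad q qs qo; rewrite ltnNge; apply/negP => kq; apply: nbad.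
  have [F [srt allF]] := sorted_staircase (@cell_homo R m) (@cell_lt R m) qo.
  exists F => //=; apply: leq_trans kq (leq_trans (size_subseq_online qs allF) _).
  apply: subset_leq_card; apply/fintype.subsetP => i; rewrite !inE => sc.
  by exists (inord (cell m (interv_of (X i w)).1), inord (cell m (interv_of (X i w)).2)) => //; apply: box_interv_of.
Qed.

Definition covering (t : R) : set (plane R) := [set p | covers t (interv_of p)].

Lemma covering_measurable t : measurable (covering t).
Proof.
pose lo : set (measurableTypeR R) := [set` `]-oo, t]].
pose hi : set (measurableTypeR R) := [set` `[t, +oo[].
have mlo : measurable lo by exact: measurable_itv.
have mhi : measurable hi by exact: measurable_itv.
rewrite (_ : covering t = (lo `*` hi) `|` (hi `*` lo)).
  by apply: measurableU; apply: measurableX.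
apply/seteqP; split=> p; rewrite /covering /covers /interv_of /= /lo /hi /= !in_itv /= !andbT ge_min le_max.
  move=> /andP[/orP[a|a] /orP[b|b]]; [|by left|by right|]; have [c|c] := leP p.1 p.2.
  - by left; split=> //; apply: le_trans b c.
  - by right; split=> //; apply: le_trans (ltW c) a.
  - by left; split=> //; apply: le_trans c a.
  - by right; split=> //; apply: le_trans b (ltW c).
by move=> [[-> ->]|[-> ->]]; rewrite ?orbT.
Qed.

(* The diagonal cells of a fine grid have a small mass, and any point outside
   them is an interval that contains one of the grid lines. *)
Lemma covering_positive : exists t, (0 < mu (covering t))%E.
Proof.
have [mu1 [f [M [f_meas f_bound density]]]] := mu_pdf.
have M0 := density_bound_ge0 f_bound.
(* As [m + 1 > 2M], the [m + 1] diagonal boxes, of mass at most [2M / (m + 1) ^ 2] each, have total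
   mass below 1. *)
pose m := (Num.truncn (2 * M)).+1.
have mM : 2 * M < m.+1%:R by rewrite /m -truncn_le_nat; apply: leqnSn.
pose t (j : 'I_m.+1) : R := j%:R / m.+1%:R.
apply: contrapT => none.
have null j : (mu (covering (t j)) <= 0%:E)%E.
  by rewrite leNgt; apply/negP => pos; apply: none; exists (t j).
pose C := \bigcup_(j in [set j : 'I_m.+1 | predT j]) covering (t j).
pose D := \bigcup_(a in [set a : 'I_m.+1 | predT a]) (box (a, a) : set (plane R)).
have mC : measurable C by apply: finite_union_measurable => j _; apply: covering_measurable.
have mD : measurable D by apply: finite_union_measurable => a _; apply: box_measurable.
have full : setT `<=` C `|` D.
  move=> p _; have [E|NE] := eqVneq (cell m (interv_of p).1) (cell m (interv_of p).2).
    right; exists (inord (cell m (interv_of p).1)) => //.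
    by have := box_interv_of m p; rewrite -E.
  left; exists (inord (cell m (interv_of p).2)) => //.
  have le12 : (interv_of p).1 <= (interv_of p).2 by rewrite /interv_of /=; case: (leP p.1 p.2) => // /ltW.
  have lt : (cell m (interv_of p).1 < cell m (interv_of p).2)%N.
    by rewrite ltn_neqAle NE; apply: cell_homo.
  have jm : (0 < cell m (interv_of p).2 <= m)%N.
    by rewrite (leq_ltn_trans _ lt) //= -ltnS cell_lt.
  rewrite /covering /covers /t /= inordK ?cell_lt // -(cell_geE _ jm) leqnn andbT.
  by apply: ltW; rewrite ltNge -(cell_geE _ jm) -ltnNge.
have muC : (mu C <= 0%:E)%E.
  by have := union_bound (fun j _ => covering_measurable (t j)) (fun j (_ : predT j) => null j); rewrite mulr0.
have muD : (mu D <= (2 * M / m.+1%:R)%:E)%E.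
  apply: (le_trans (union_bound (fun a _ => box_measurable (R := R) (a, a))
    (fun a (_ : predT a) => box_le mu1 f_meas f_bound density (a, a)))).
  rewrite lee_fin cardT size_enum_ord.
  have : m.+1%:R != 0 :> R by rewrite pnatr_eq0.
  move: (m.+1%:R : R) => N N0; rewrite le_eqVlt; apply/orP; left; apply/eqP.
  by field.
have : (mu setT <= mu C + mu D)%E.
  apply: le_trans (measureU2 mu mC mD); apply: le_measure => //; rewrite inE //.
  exact: measurableU.
rewrite probability_setT => le1.
have := le_trans le1 (leeD muC muD); rewrite add0e lee_fin.
by rewrite leNgt ltr_pdivrMr // mul1r mM.
Qed.

Lemma big_clique_likely : exists (t : R) (D : nat) (rho : R),
  [/\ (0 < D)%N, 0 < rho < 1 &
  forall (n : nat) (d : measure_display) (T : measurableType d)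
    (P : probability T R) (X : 'I_n -> {RV P >-> plane R}), iid mu X ->
  exists bad : set T, [/\ measurable bad, (P bad <= (rho ^+ n./2)%:E)%E &
    forall w, ~ bad w ->
      (n %/ D <= #|[set i | covers t (interv_of (X i w))]%SET|)%N]].
Proof.
have [t pos] := covering_positive.
have mA := covering_measurable t.
pose q := fine (mu (covering t)).
have qE : mu (covering t) = q%:E by rewrite fineK // fin_num_measure.
have q0 : 0 < q by rewrite -lte_fin -qE.
(* The maximum keeps [r] positive even if [covering t] has full mass. *)
pose r := Num.max (1 - q) 2^-1.
have r01 : 0 < r < 1.
  rewrite /r lt_max gt_max invr_gt0 ltr0n orbT /= invf_lt1 ?ltr1n // andbT.
  by rewrite ltrBlDr ltrDl.
have [D [rho [D0 rho01 num]]] := clique_numeric r01.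
exists t, D, rho; split=> // n d T P X X_iid.
have [mB PB] := many_in_set_bound X_iid (n - n %/ D) (measurableC mA).
exists [set w | (n - n %/ D <= #|[set i | X i w \in ~` covering t]%SET|)%N]; split=> //.
  apply: (le_trans (PB r _)); last by rewrite lee_fin; apply: num.
  by rewrite probability_setC // qE -EFinB lee_fin le_max lexx.
move=> w /=; move/negP; rewrite -ltnNge => lt.
have := cardsC [set i | X i w \in ~` covering t]%SET; rewrite card_ord.
have -> : (~: [set i | X i w \in ~` covering t] = [set i | covers t (interv_of (X i w))])%SET.
  by apply/setP => i; rewrite !inE in_setC negbK; apply/idP/idP => [/set_mem|H] //; apply/mem_set.
move: lt; rewrite -/(n %/ D)%N; have := leq_div n D.
by move: #|_| #|_| => a b; lia.
Qed.

End RareEvents.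

(** * Invariance under order isomorphisms *)

Section OrderInvariance.
Variable R : realType.
Implicit Types (I J : interv R) (s : stateB R).

Section Transport.
Variables (S : R -> Prop) (f : R -> R).
Hypothesis f_le : forall x y, S x -> S y -> (f x <= f y) = (x <= y).

Definition in_S J : Prop := S J.1 /\ S J.2.

Definition state_in s : Prop :=
  (forall c p, c \in chains s -> p \in c -> in_S p.1) /\
  (forall q, q \in times s -> S q.2).

Definition map_interv J : interv R := (f J.1, f J.2).

Definition map_chain (c : chain R) : chain R := [seq (map_interv p.1, p.2) | p <- c].

Definition map_times (D : seq (nat * R)) : seq (nat * R) := [seq (p.1, f p.2) | p <- D].

Definition map_state s : stateB R :=
  StateB [seq map_chain c | c <- chains s] (map_times (times s)) (ncol s).

Lemma f_lt x y : S x -> S y -> (f x < f y) = (x < y).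
Proof. by move=> Sx Sy; rewrite !ltNge f_le. Qed.

Lemma contains_map J I : in_S J -> in_S I ->
  contains (map_interv J) (map_interv I) = contains J I.
Proof. by move=> [? ?] [? ?]; rewrite /contains /= !f_le. Qed.

Lemma bottom_color_map D chi I d D' chi' : (forall q, q \in D -> S q.2) -> in_S I ->
  bottom_color D chi I d D' chi' ->
  bottom_color (map_times D) chi (map_interv I) d (map_times D') chi' /\
  (forall q, q \in D' -> S q.2).
Proof.
move=> SD [SI1 SI2] bc; case: bc SD => {d D' chi'} [noD|D1 D2 d y DE yI] SD; split.
- by apply: BottomNew => _ /mapP[q qD ->] /=; rewrite f_lt //; [apply: noD|apply: SD].
- by move=> q; rewrite inE => /orP[/eqP->|/SD].
- have Sy : S y by apply: (SD (d, y)); rewrite DE mem_cat mem_head orbT.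
  rewrite DE /map_times !map_cat /=; apply: BottomReuse; first reflexivity.
  by rewrite f_lt.
- move=> q; rewrite mem_cat inE => /or3P[qD|/eqP->//|qD]; apply: SD; rewrite DE mem_cat.
    by rewrite qD.
  by rewrite inE qD !orbT.
Qed.

Lemma best_chain_map I C1 J d c C2 : in_S I ->
  (forall c' p, c' \in C1 ++ ((J, d) :: c) :: C2 -> p \in c' -> in_S p.1) ->
  best_chain I C1 J d c C2 ->
  best_chain (map_interv I) (map map_chain C1) (map_interv J) d (map_chain c)
    (map map_chain C2).
Proof.
move=> SI SC [JI best].
have SJ : in_S J by apply: (SC ((J, d) :: c) (J, d)); rewrite ?mem_head // mem_cat mem_head orbT.
split=> [|K e c']; first by rewrite contains_map.
rewrite -[_ :: map_chain c]/(map_chain ((J, d) :: c)) -map_cons -map_cat.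
move=> /mapP[[|[J' d'] c''] cC //= [-> _ _]].
have SJ' : in_S J' by apply: (SC _ (J', d') cC); rewrite mem_head.
rewrite contains_map // => J'I; rewrite f_le; [|by case: SJ|by case: SJ'].
exact: best cC J'I.
Qed.

(** A step only compares endpoints, so it is transported by any [f] that preserves their order. This
    is known on [S] only, hence the invariant [state_in]. *)
Lemma stepB_map h s I d s' : state_in s -> in_S I -> stepB h s I d s' ->
  stepB h (map_state s) (map_interv I) d (map_state s') /\ state_in s'.
Proof.
move=> [SC SD] SI st; case: st => {s'} [{}d D' chi' nc bc|C1 J {}d c C2 sE best lt|
  C1 J dJ c C2 {}d D' chi' sE best ge bc].
- have [bc' SD'] := bottom_color_map SD SI bc; split; last first.
    split=> //= c p; rewrite inE => /orP[/eqP->|]; last exact: SC.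
    by rewrite inE => /eqP->.
  apply: (@StepNewChain R h (map_state s)) bc'; rewrite /= has_map; apply/hasPn => c cs /=.
  have := hasPn nc _ cs; case: c cs => // -[J e] c cs /=.
  rewrite contains_map //; exact: (SC _ (J, e) cs (mem_head _ _)).
- rewrite sE in SC; split.
    rewrite [map_state (StateB _ _ _)]/map_state /= map_cat /=.
    apply: (@StepSameColor R h (map_state s)) (best_chain_map SI SC best) _.
      by rewrite /= sE map_cat.
    by move: lt; rewrite /count_color /= count_map.
  split=> //= c' p; rewrite mem_cat inE => /or3P[c'C|/eqP->|c'C].
  + by apply: SC; rewrite mem_cat c'C.
  + rewrite inE => /orP[/eqP->//|]; apply: SC.
    by rewrite mem_cat mem_head orbT.
  + by apply: SC; rewrite mem_cat inE c'C !orbT.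
- rewrite sE in SC; have [bc' SD'] := bottom_color_map SD SI bc; split.
    rewrite [map_state (StateB _ _ _)]/map_state /= map_cat /=.
    apply: (@StepBottom R h (map_state s)) (best_chain_map SI SC best) _ bc'.
      by rewrite /= sE map_cat.
    by move: ge; rewrite /count_color /= count_map.
  split=> //= c' p; rewrite mem_cat inE => /or3P[c'C|/eqP->|c'C].
  + by apply: SC; rewrite mem_cat c'C.
  + rewrite inE => /orP[/eqP->//|]; apply: SC.
    by rewrite mem_cat mem_head orbT.
  + by apply: SC; rewrite mem_cat inE c'C !orbT.
Qed.

Lemma runB_map h s Is ds s' : state_in s -> (forall J, J \in Is -> in_S J) ->
  runB h s Is ds s' -> runB h (map_state s) (map map_interv Is) ds (map_state s').
Proof.
elim: Is s ds => [|I Is IH] s [|d ds] //= Ss SIs; first by move=> ->.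
move=> [s1 [st run]]; have [st' Ss1] := stepB_map Ss (SIs _ (mem_head _ _)) st.
by exists (map_state s1); split=> //; apply: IH => // J JIs; apply: SIs; rewrite inE JIs orbT.
Qed.

End Transport.

Definition endpoint (a : bool) (p : R * R) : R := if a then p.1 else p.2.

Definition same_order (n : nat) (I I' : 'I_n -> R * R) : Prop := forall i a j b,
  (endpoint a (I i) <= endpoint b (I j)) = (endpoint a (I' i) <= endpoint b (I' j)).

Lemma same_order_sym n (I I' : 'I_n -> R * R) : same_order I I' -> same_order I' I.
Proof. by move=> so i a j b; rewrite so. Qed.

(** The order pattern tells which coordinate is the smaller one, so sorting a pair selects the same
    coordinates in both instances. *)
Lemma same_order_interv_of n (v v' : 'I_n -> R * R) : same_order v v' ->
  same_order (fun i => interv_of (v i)) (fun i => interv_of (v' i)).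
Proof.
move=> so.
have pick i a : exists b, endpoint a (interv_of (v i)) = endpoint b (v i) /\
                          endpoint a (interv_of (v' i)) = endpoint b (v' i).
  have := so i true i false; rewrite /interv_of /=.
  case: (leP (v i).1 (v i).2) => _; case: (leP (v' i).1 (v' i).2) => _ // _.
    by exists a; case: a.
  by exists (~~ a); case: a.
move=> i a j b /=; have [a' [-> ->]] := pick i a; have [b' [-> ->]] := pick j b.
exact: so.
Qed.

Section SameOrder.
Variables (h n : nat) (I I' : 'I_n -> interv R).
Hypothesis so : same_order I I'.

Lemma same_order_lt i a j b :
  (endpoint a (I i) < endpoint b (I j)) = (endpoint a (I' i) < endpoint b (I' j)).
Proof. by rewrite !ltNge so. Qed.

Lemma colorable_same_order k : colorable h I k -> colorable h I' k.
Proof.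
move=> [c [ov cap]]; exists c; split=> [i j|t d].
  move=> o; apply: ov; move: o; rewrite /overlap.
  by rewrite -!(same_order_lt _ true _ true) -!(same_order_lt _ true _ false) -!(same_order_lt _ false _ false).
set A := [set i | _]%SET; have [->|[i0 i0A]] := set_0Vmem A; first by rewrite cards0.
(* A real [t] has no counterpart in the other instance; it is replaced by the latest starting point
   among the intervals counted, which they all contain. *)
have [i iA imax] : exists2 i, i \in A & forall j, j \in A -> (I' j).1 <= (I' i).1.
  by case: (arg_maxP (fun i => (I' i).1) i0A) => i iA imax; exists i.
apply: leq_trans (cap (I i).1 d); apply: subset_leq_card; apply/fintype.subsetP => j jA.
have ij := imax j jA; move: iA jA; rewrite !finset.inE => /andP[_ /andP[it _]] /andP[-> /andP[_ tj]] /=.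
apply/andP; split; first by rewrite (so j true i true).
by rewrite (so i true j false); apply: le_trans it tj.
Qed.

Lemma runB_same_order ds s : runB h (initB R) (online_input I') ds s ->
  exists2 s', runB h (initB R) (online_input I) ds s' & ncol s' = ncol s.
Proof.
pose S x := exists i a, endpoint a (I' i) = x.
have [f fE] : exists f : R -> R, forall i a, f (endpoint a (I' i)) = endpoint a (I i).
  (* Well defined, since endpoints equal in [I'] are equal in [I]; the value 0 off the endpoints is
     arbitrary. *)
  have /choice[f fP] : forall x, exists y, forall i a, endpoint a (I' i) = x -> endpoint a (I i) = y.
    move=> x; have [[i0 [a0 <-]]|no] := pselect (S x).
      exists (endpoint a0 (I i0)) => i a e.
      by apply/eqP; rewrite eq_le !so e lexx.
    by exists 0 => i a e; case: no; exists i, a.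
  by exists f => i a; rewrite -(fP _ i a erefl).
have f_le x y : S x -> S y -> (f x <= f y) = (x <= y).
  by move=> [i [a <-]] [j [b <-]]; rewrite !fE so.
move=> run; have fI i : map_interv f (I' i) = I i.
  by rewrite /map_interv (fE i true) (fE i false) -surjective_pairing.
(* Both inputs come from sorting the indices by the same relation, so ties are broken alike. *)
have -> : online_input I = map (map_interv f) (online_input I').
  rewrite /online_input (sort_map (f := I)) (sort_map (f := I')); apply/esym; rewrite -[LHS]map_comp.
  rewrite (eq_map (fI : map_interv f \o I' =1 I)).
  apply: (f_equal (fun r => map I (sort r (enum 'I_n)))).
  by apply/funext => i; apply/funext => j; rewrite /= (so i true j true).
exists (map_state f s) => //; apply: (runB_map f_le (s := initB R)) run => //.
by move=> J; rewrite mem_sort => /mapP[i _ ->]; split; [exists i, true|exists i, false].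
Qed.

End SameOrder.

Lemma opt_colors_same_order h n (I I' : 'I_n -> interv R) : same_order I I' ->
  opt_colors h I = opt_colors h I'.
Proof.
move=> so; rewrite /opt_colors; have -> // : colorable h I = colorable h I'.
by apply/funext => k; apply/propext; split; apply: colorable_same_order => //; apply: same_order_sym.
Qed.

(** Outcomes with the same table of comparisons are all in [E] or all outside, so the event is a
    union of classes; there are finitely many tables, and each is a measurable event. *)
Lemma order_invariant_measurable (d : measure_display) (T : measurableType d)
    (P : probability T R) (n : nat) (X : 'I_n -> {RV P >-> plane R}) (E : set ('I_n -> R * R)) :
  (forall v v', same_order v v' -> E v -> E v') ->
  measurable [set w | E (fun i => X i w)].
Proof.
move=> inv; pose K := (('I_n * bool) * ('I_n * bool))%type.
pose cmp w (x : K) := endpoint x.1.2 (X x.1.1 w) <= endpoint x.2.2 (X x.2.1 w).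
have m_end i a : measurable_fun setT (fun w => endpoint a (X i w) : measurableTypeR R).
  have mX : measurable_fun setT (X i) by exact: measurable_funPT.
  by case: a; [exact: (measurableT_comp measurable_fst mX)|exact: (measurableT_comp measurable_snd mX)].
have m_cmp x b : measurable [set w | cmp w x = b].
  have m1 : measurable [set w | cmp w x].
    have := measurable_fun_le measurableT (m_end x.1.1 x.1.2) (m_end x.2.1 x.2.2).
    by rewrite setTI.
  case: b => //; rewrite (_ : [set _ | _] = ~` [set w | cmp w x]); first exact: measurableC.
  by apply/seteqP; split=> w /=; [move=> ->|move=> /negP/negbTE].
pose fib (g : {ffun K -> bool}) := \bigcap_(x in [set: K]) [set w | cmp w x = g x].
pose Q (g : {ffun K -> bool}) := `[< exists2 w, E (fun i => X i w) & fib g w >].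
rewrite (_ : [set w | _] = \bigcup_(g in [set g | Q g]) fib g).
  apply: finite_union_measurable => g _; apply: fin_bigcap_measurable => [|x _].
    exact: finite_finset.
  exact: m_cmp.
apply/seteqP; split=> w /=.
  move=> Ew; exists [ffun x => cmp w x]; last by move=> x _ /=; rewrite ffunE.
  by apply/asboolP; exists w => // x _ /=; rewrite ffunE.
move=> [g /= /asboolP[w' Ew' fw'] fw]; apply: inv Ew' => i a j b.
by have := fw' ((i, a), (j, b)) I; have := fw ((i, a), (j, b)) I; rewrite /cmp /= => -> ->.
Qed.

End OrderInvariance.

(** * Conclusion *)

(** The excess is at most [L * N / chi], with [N <= 2 * sqrt n] and [n <= 2 * D * h * chi]. *)
Lemma ratio_le (R : realType) (L D n N h chi c : nat) :
  (0 < D <= n)%N -> N%:R <= 2 * Num.sqrt n%:R :> R -> (n %/ D <= h * chi)%N ->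
  (c <= chi + L * N)%N ->
  c%:R / chi%:R <= 1 + (4 * L * D)%:R * h%:R * n%:R `^ (- 2^-1) :> R.
Proof.
move=> /andP[D0 Dn] N_le clique c_le.
have q0 : (0 < n %/ D)%N by rewrite divn_gt0.
have chi0 : (0 < chi)%N by case: chi clique {c_le} => //; rewrite muln0; lia.
have n0 : (0 < n)%N by lia.
have s0 : 0 < Num.sqrt n%:R :> R by rewrite sqrtr_gt0 ltr0n.
(* As [n %/ D] is at least 1, rounding loses at most a factor 2. *)
have n_le : (n <= 2 * D * (h * chi))%N.
  have := ltn_ceil n D0; rewrite mulSn => lt.
  apply: leq_trans (leq_mul (leqnn _) clique).
  by have := leq_pmull D q0; nia.
rewrite powRN powR12_sqrt // ler_pdivrMr ?ltr0n // mulrDl mul1r.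
apply: (@le_trans _ _ (chi + L * N)%:R); first by rewrite ler_nat.
rewrite natrD lerD2l natrM.
apply: (@le_trans _ _ (L%:R * (2 * Num.sqrt n%:R))); first by apply: ler_wpM2l.
have -> : (4 * L * D)%:R * h%:R * (Num.sqrt n%:R)^-1 * chi%:R =
    L%:R * (2 * ((2 * D * (h * chi))%:R / Num.sqrt n%:R)) :> R.
  by rewrite !natrM; ring.
apply: ler_wpM2l => //; apply: ler_wpM2l => //.
by rewrite ler_pdivlMr // -expr2 sqr_sqrtr // ler_nat.
Qed.

Definition grid_size (R : realType) (n : nat) : nat := (Num.truncn (Num.sqrt (n%:R : R))).+1.

Lemma grid_size_sqr (R : realType) n : (n <= grid_size R n ^ 2)%N.
Proof.
rewrite -(ler_nat R) natrX -[leLHS]sqr_sqrtr //; apply: lerXn2r; rewrite ?nnegrE ?sqrtr_ge0 //.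
by apply: ltW; rewrite -truncn_le_nat.
Qed.

Lemma grid_size_le (R : realType) n : (0 < n)%N ->
  (grid_size R n)%:R <= 2 * Num.sqrt n%:R :> R.
Proof.
move=> n0; rewrite /grid_size -natr1 [2]/(1 + 1) mulrDl mul1r; apply: lerD.
  by rewrite truncn_le sqrtr_ge0.
by rewrite -{1}sqrtr1 ler_wsqrtr // ler1n.
Qed.

Lemma cvg_pow_comp (R : realType) (r : R) (u : nat -> nat) : 0 < r < 1 ->
  (forall A, \forall n \near \oo, (A <= u n)%N) -> r ^+ u n @[n --> \oo] --> (0 : R).
Proof.
move=> /andP[r0 r1] uoo.
have u_cvg : u n @[n --> \oo] --> \oo by apply/cvgnyPge.
by apply: (cvg_comp _ _ u_cvg); apply: cvg_expr; rewrite gtr0_norm.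
Qed.

Theorem theorem1 (R : realType) :
  (forall mu : probability (plane R) R,
     bounded_pdf_on_unit_square mu ->
     exists2 K : R, 0 < K &
       forall (h : nat -> nat), (forall n, (0 < h n)%N) ->
       forall (d : nat -> measure_display)
              (T : forall n, measurableType (d n))
              (P : forall n, probability (T n) R)
              (X : forall n, 'I_n -> {RV (P n) >-> plane R}),
         (forall n, iid mu (X n)) ->
         whp P (fun n => [set w : T n |
           let inst := fun i : 'I_n => interv_of (X n i w) in
           forall (ds : seq nat) (s : stateB R),
             runB (h n) (initB R) (online_input inst) ds s ->
             (ncol s)%:R / (opt_colors (h n) inst)%:R
               <= 1 + K * (h n)%:R * n%:R `^ (- 2^-1) :> R]))
  /\
  (exists (p : cmd) (C : R),
     forall (h n : nat) (Is : seq (interv R)),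
       (0 < h)%N -> (2 <= n)%N -> size Is = n -> valid_input Is ->
       exists (ds : seq nat) (s : stateB R),
         runB h (initB R) Is ds s /\
         processes p (C * ln n%:R) (init_memory R h) Is ds).
Proof.
split; last exact: online_time.
move=> mu mu_pdf; have [L L0 chains_short] := long_chain_rare mu_pdf.
have [t [D [rho [D0 rho01 clique_big]]]] := big_clique_likely mu_pdf.
exists (4 * L * D)%:R; first by rewrite ltr0n !muln_gt0 L0 D0.
move=> h h0 d T P X X_iid; set E := (fun n => _).
have mE n : measurable (E n).
  pose F (v : 'I_n -> R * R) := forall (ds : seq nat) (s : stateB R),
    runB (h n) (initB R) (online_input (fun i => interv_of (v i))) ds s ->
    (ncol s)%:R / (opt_colors (h n) (fun i => interv_of (v i)))%:R
      <= 1 + (4 * L * D)%:R * (h n)%:R * n%:R `^ (- 2^-1) :> R.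
  apply: (order_invariant_measurable (X n) (E := F)) => v v' so Fv ds s run.
  have so' := same_order_interv_of so.
  have [s' run' <-] := runB_same_order so' run.
  by rewrite -(opt_colors_same_order (h n) so'); apply: Fv run'.
split=> //; pose N := grid_size R.
(* The bounds for an overlong increasing sequence and for too few intervals at [t]; both exponents
   tend to infinity. *)
pose err n : R := 2^-1 ^+ N n + rho ^+ n./2.
have E_likely n : (D <= n)%N -> ((1 - err n)%:E <= P n (E n))%E.
  move=> Dn; have n0 : (0 < n)%N by lia.
  have [b1 [mb1 Pb1 b1P]] :=
    chains_short n (N n) _ _ _ _ isT (grid_size_sqr R n) (X_iid n).
  have [b2 [mb2 Pb2 b2P]] := clique_big n _ _ _ _ (X_iid n).
  have mb : measurable (b1 `|` b2) by apply: measurableU.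
  have sub : ~` (b1 `|` b2) `<=` E n.
    rewrite setCU => w [/= nb1 nb2] ds s run; set inst := (fun i => _) in run *.
    have inst12 i : (inst i).1 <= (inst i).2.
      by rewrite /inst /interv_of /=; case: (leP (X n i w).1 (X n i w).2) => // /ltW.
    have [q [qs qo c_le]] := run_ncol (h0 n) inst12 run.
    apply: (@ratio_le R L D n (N n)).
    - by rewrite D0.
    - exact: grid_size_le.
    - apply: leq_trans (covers_opt inst t (h0 n)); rewrite count_online.
      exact: b2P.
    - apply: leq_trans c_le _; rewrite leq_add2l ltnW //.
      exact: b1P qs qo.
  have Psub : (P n (~` (b1 `|` b2)) <= P n (E n))%E.
    by apply: le_measure => //; rewrite inE //; apply: measurableC.
  apply: le_trans Psub.
  rewrite probability_setC // EFinB; apply: leeB => //.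
  by apply: le_trans (measureU2 (P n) mb1 mb2) _; rewrite EFinD; apply: leeD.
have err0 : err n @[n --> \oo] --> (0 : R).
  rewrite -[0]addr0; apply: cvgD; apply: cvg_pow_comp => //.
  - by rewrite invr_gt0 ltr0n /= invf_lt1 ?ltr1n.
  - move=> A; exists (A ^ 2)%N => // n /= An; rewrite leqW // truncn_ge_nat ?sqrtr_ge0 //.
    by rewrite -[leLHS]ger0_norm // -sqrtr_sqr ler_wsqrtr // -natrX ler_nat.
  - by move=> A; exists A.*2 => // n /= An; lia.
apply: (squeeze_cvge (f := fun n => (1 - err n)%:E) (h := fun=> 1%E)).
- by exists D => // n /= Dn; rewrite E_likely // probability_le1.
- apply: cvg_EFin; first by near=> n.
  by rewrite -[X in _ --> X]subr0; apply: cvgB => //; apply: cvg_cst.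
- exact: cvg_cst.
Unshelve. all: by end_near.
Qed.
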